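(* For every finite alphabet $\Sigma$, the learning problem for $\mathbf{LTL}(\mathbf{F},\wedge)$ is in $\mathsf{NP}$: given words $u_1,\dots,u_n,v_1,\dots,v_n\in\Sigma^*$ and $k\in\mathbb{N}$ in binary, deciding whether some formula of $\mathbf{LTL}(\mathbf{F},\wedge)$ of size at most $k$ separates $u_1,\dots,u_n$ from $v_1,\dots,v_n$ is in $\mathsf{NP}$.
   Context: Words are nonempty and indexed from position 1. $\mathbf{LTL}(\mathbf{F},\wedge)$: formulas built from letters $c\in\Sigma$, $\wedge$ and $\mathbf{F}$; semantics on a word $w$ of length $\ell$ at position $i\in[1,\ell]$: $w,i\models c$ iff $w(i)=c$; $\wedge$ as usual; $w,i\models\mathbf{F}\phi$ iff $w,i'\models\phi$ for some $i'\in[i,\ell]$; $w\models\phi$ iff $w,1\models\phi$. Size = number of nodes in the syntax tree. A formula separates $u_1,\dots,u_n$ from $v_1,\dots,v_n$ if all $u_j\models\phi$ and all $v_j\not\models\phi$. *)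

(* Defs.v *)
From mathcomp Require Import all_boot.
Set Implicit Arguments. Unset Strict Implicit. Unset Printing Implicit Defensive.

Inductive ltlFA (S : Type) : Type :=
| LAtom : S -> ltlFA S
| LAnd  : ltlFA S -> ltlFA S -> ltlFA S
| LF    : ltlFA S -> ltlFA S.

Fixpoint fsize (S : Type) (phi : ltlFA S) : nat :=
  match phi with
  | LAtom _ => 1
  | LAnd a b => (fsize a + fsize b).+1
  | LF a => (fsize a).+1
  end.

(* w, i |= phi, positions indexed from 1; w(i) = nth _ w (i-1) *)
Fixpoint sat (S : eqType) (w : seq S) (i : nat) (phi : ltlFA S) : Prop :=
  match phi with
  | LAtom c => (0 < i <= size w) /\ nth c w i.-1 = c
  | LAnd a b => sat w i a /\ sat w i b
  | LF a => exists i', i <= i' <= size w /\ sat w i' a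
  end.

Definition models (S : eqType) (w : seq S) (phi : ltlFA S) : Prop := sat w 1 phi.

Definition separates (S : eqType) (us vs : seq (seq S)) (phi : ltlFA S) : Prop :=
  (forall u, u \in us -> models u phi) /\ (forall v, v \in vs -> ~ models v phi).

Definition valid_instance (S : eqType) (us vs : seq (seq S)) : Prop :=
  size us = size vs /\ (forall w, w \in us ++ vs -> 0 < size w).

Definition LTL_learning (S : eqType) (us vs : seq (seq S)) (k : nat) : Prop :=
  valid_instance us vs /\ exists phi : ltlFA S, fsize phi <= k /\ separates us vs phi.

(*   inl c = letter c ; inr 0 = end of word ; inr 1 = end of list ;        *)
(*   inr 2 = bit 0 ; inr 3 = bit 1                                          *)

Definition tok (S : finType) : finType := (S + 'I_4)%type.

Definition t_eow (S : finType) : tok S := inr (inord 0).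
Definition t_eol (S : finType) : tok S := inr (inord 1).
Definition t_bit (S : finType) (b : bool) : tok S := inr (inord (if b then 3 else 2)).

(* binary expansion, least significant bit first, no leading zeros (0 = [::]) *)
Fixpoint bits_fuel (f k : nat) : seq bool :=
  match f with
  | 0 => [::]
  | f'.+1 => if k == 0 then [::] else odd k :: bits_fuel f' k./2
  end.
Definition bin (k : nat) : seq bool := bits_fuel k k.

Definition enc_words (S : finType) (ws : seq (seq S)) : seq (tok S) :=
  flatten [seq rcons (map inl w) (t_eow S) | w <- ws] ++ [:: t_eol S].

Definition encode (S : finType) (us vs : seq (seq S)) (k : nat) : seq (tok S) :=
  enc_words us ++ enc_words vs ++ map (t_bit S) (bin k).

Definition LTL_learning_lang (S : finType) (x : seq (tok S)) : Prop :=
  exists (us vs : seq (seq S)) (k : nat), x = encode us vs k /\ LTL_learning us vs k.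

(* Deterministic single-tape Turing machines (two-way infinite tape)       *)

Inductive move := MLeft | MRight | MStay.

Record TM (A : Type) := {
  tm_state : finType;
  tm_sym   : finType;
  tm_blank : tm_sym;
  tm_input : A -> tm_sym;
  tm_start : tm_state;
  tm_acc   : pred tm_state;
  tm_rej   : pred tm_state;
  tm_delta : tm_state -> tm_sym -> tm_state * tm_sym * move }.

(* configuration: state, cells left of head (nearest first), cells from head on *)
Definition cfg A (M : TM A) : Type :=
  (tm_state M * seq (tm_sym M) * seq (tm_sym M))%type.

Definition tm_init A (M : TM A) (x : seq A) : cfg M :=
  (tm_start M, [::], map (tm_input M) x).

Definition tm_step A (M : TM A) (c : cfg M) : cfg M :=
  let: (q, L, R) := c in
  if @tm_acc _ M q || @tm_rej _ M q then c else
  let: (q', b, m) := @tm_delta _ M q (head (tm_blank M) R) in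
  match m with
  | MStay  => (q', L, b :: behead R)
  | MRight => (q', b :: L, behead R)
  | MLeft  => (q', behead L, head (tm_blank M) L :: b :: behead R)
  end.

(* M accepts x within t steps (halting states are absorbing) *)
Definition accepts_within A (M : TM A) (x : seq A) (t : nat) : bool :=
  let: (q, _, _) := iter t (@tm_step A M) (tm_init M x) in @tm_acc _ M q.

Definition poly_bound (c d n : nat) : nat := c * n ^ d + c.

Definition vinput (A : Type) (x : seq A) (y : seq bool) : seq (A + option bool) :=
  map inl x ++ inr None :: map (fun b => inr (Some b)) y.

Definition in_NP (A : finType) (L : seq A -> Prop) : Prop :=
  exists (V : TM (A + option bool)%type) (c d : nat),
    forall x : seq A,
      L x <-> exists y : seq bool,
        size y <= poly_bound c d (size x) /\
        accepts_within V (vinput x y) (poly_bound c d (size x)).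

(* Main.v *)
(** On a nonempty word, [F] is monotone: the earlier the position, the more
    formulas [F phi] hold there.  Hence [F (c /\ F a /\ F b)] is equivalent to
    [F (c /\ F a) /\ F (c /\ F b)], and every satisfiable formula is equivalent to a
    conjunction of patterns [c1 /\ F (c2 /\ F ...)], arranged as a tree whose number
    of nodes determines the size of the formula.  A negative word is rejected as
    soon as one pattern fails on it, and a pattern without repeated consecutive
    letters that matches a positive word [u] has length at most [|u|].  So a
    depth-first traversal of the tree that visits only the subtrees rejecting a
    not yet rejected negative word has polynomial length.  This traversal is the
    certificate; it is checked by a while-program over six stacks, which a
    single-tape machine simulates by storing the stacks on parallel tracks. *)

Require Import Defs.
From mathcomp Require Import all_boot zify.

Set Implicit Arguments. Unset Strict Implicit. Unset Printing Implicit Defensive.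

(** * Formulas as trees of patterns *)

Section Patterns.
Variable S : finType.
Implicit Types (w v p q : seq S) (us vs : seq (seq S)) (c d a : S) (r : option S).

(** As [k] is given in binary, a formula of size [k] can be exponentially longer than the input, so
    the formula itself cannot be guessed. The length of a traversal is bounded by charging: a branch
    is entered only if some negative word is rejected inside it; that word pays for the way down and
    the way back, once per depth, and the depth is bounded by the length of one positive word. Size
    accounting is exact: a tree node stands for one [LAnd], one [LF] and one letter, with a
    correction at the root only. The verifier never builds the tree; it exists only in the soundness
    invariant, and a run keeps just the current path, the surviving negative words and the remaining
    budget.

    Soundness ranges over all inputs and all bit strings, malformed ones included. Each program
    therefore comes with two kinds of facts: a timed run on good data, and the existence of an
    aborted run on bad data. An abort is a halting state of the machine, so determinism turns an
    aborted run into non-acceptance for every time bound. *)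

Fixpoint some_suffix (P : pred (seq S)) w : bool :=
  if w is _ :: w' then P w || some_suffix P w' else false.

Lemma eq_some_suffix (P Q : pred (seq S)) w :
  P =1 Q -> some_suffix P w = some_suffix Q w.
Proof. by move=> PQ; elim: w => //= a w ->; rewrite PQ. Qed.

Fixpoint satb w (phi : ltlFA S) : bool :=
  match phi with
  | LAtom c => ohead w == Some c
  | LAnd a b => satb w a && satb w b
  | LF a => some_suffix (satb^~ a) w
  end.

Lemma some_suffixP (P : pred (seq S)) w :
  reflect (exists2 j, j < size w & P (drop j w)) (some_suffix P w).
Proof.
elim: w => [|a w IH] /=; first by constructor; case.
apply: (iffP orP) => [[H|/IH[j jw H]]|[[|j] jw H]].
- by exists 0.
- by exists j.+1.
- by left.
- by right; apply/IH; exists j.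
Qed.

(** [F] never looks to the left, so truth at a position is a property of the suffix that starts
    there. *)
Lemma satP w i phi : 0 < i <= size w -> sat w i phi <-> satb (drop i.-1 w) phi.
Proof.
elim: phi i => [c|a IHa b IHb|a IH] i Hi /=.
- rewrite Hi; case: i Hi => // i /= Hi.
  rewrite (drop_nth c) //=; split=> [[_ ->]//|/eqP[->]//].
- split=> [[/(IHa _ Hi)-> /(IHb _ Hi)->]//|/andP[? ?]].
  by split; [apply/IHa|apply/IHb].
- split=> [[j [Hj /IH Ha]]|/some_suffixP[j]].
    apply/some_suffixP; exists (j - i); first by rewrite size_drop; lia.
    by rewrite drop_drop (_ : _ + _ = j.-1); [apply: Ha; lia|lia].
  rewrite size_drop drop_drop => Hj Ha; exists (i + j); split; first lia.
  by apply/IH; [lia|rewrite (_ : _.-1 = j + i.-1) //; lia].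
Qed.

Lemma modelsP w phi : 0 < size w -> models w phi <-> satb w phi.
Proof. by move=> Hw; rewrite /models (satP (i := 1)) ?drop0. Qed.

(* [F] is reflexive, so one position may serve several letters of a pattern. *)
Fixpoint pmatch p w : bool :=
  if p is c :: p' then some_suffix (fun w' => (ohead w' == Some c) && pmatch p' w') w
  else true.

Lemma pmatch_cons p a w : pmatch p w -> pmatch p (a :: w).
Proof. by case: p => //= c p ->; rewrite orbT. Qed.

Lemma pmatch_drop p j w : pmatch p (drop j w) -> pmatch p w.
Proof. by elim: w j => [|a w IH] [|j] //= /IH/pmatch_cons. Qed.

(** A letter [c] at the head of the word can be used at once: whatever matches [p] from a later [c]
    also matches it from here. This turns [pmatch] into a single left-to-right scan, which is what
    the verifier runs. *)
Lemma pmatch_greedy c p a w :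
  pmatch (c :: p) (a :: w) = if a == c then pmatch p (a :: w) else pmatch (c :: p) w.
Proof.
rewrite /= (inj_eq Some_inj); case: eqP => [->|//] /=.
apply/orb_idr => /some_suffixP[j _ /andP[_ H]].
by apply/pmatch_cons/(pmatch_drop H).
Qed.

(* Since an earlier position satisfies more patterns, the first occurrence of
   [c] serves all the patterns at once; this is why conjunction commutes with
   [F] below a letter. *)
Lemma some_suffix_all c (Q : seq (seq S)) w : Q != [::] ->
  some_suffix (fun w' => (ohead w' == Some c) && all (pmatch^~ w') Q) w
  = all (fun q => pmatch (c :: q) w) Q.
Proof.
move=> Q0; elim: w => [|a w IH]; first by case: Q Q0.
under eq_all => q do rewrite pmatch_greedy.
rewrite /= IH (inj_eq Some_inj); case: eqP => //= _.
apply/orb_idr => /allP H; apply/allP => q /H /some_suffixP[j _ /andP[_ M]].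
exact/pmatch_cons/(pmatch_drop M).
Qed.

(** The position that serves the first [c] also serves the second. Repeated neighbours can thus be
    dropped from a path, which is what makes a bound on its length possible. *)
Lemma pmatch_stutter c p q w : pmatch (rcons p c ++ c :: q) w = pmatch (rcons p c ++ q) w.
Proof.
elim: p w => [|d p IH] w; last by apply: eq_some_suffix => w'; congr (_ && _); apply: IH.
elim: w => // a w IHw; rewrite [rcons _ _]/= !cat_cons !cat0s in IHw *.
by rewrite !pmatch_greedy IHw; case: eqP.
Qed.

(** The position used for one letter cannot serve a different next letter, so the greedy scan spends
    a fresh position on each letter. *)
Lemma pmatch_size p w : sorted (fun x y => x != y) p -> pmatch p w -> size p <= size w.
Proof.
elim: w p => [|a w IH] [|c p] //; rewrite pmatch_greedy.
case: eqP => [->|_] sp; last by move/IH => H; apply: leqW; apply: H.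
case: p sp => // d p /andP[cd sp]; rewrite pmatch_greedy (negPf cd) => H.
by have := IH (d :: p) sp H; rewrite /= ltnS.
Qed.

(* [Br t c u] stands for [t /\ F (c /\ u)] *)
Inductive tree := Leaf | Br of tree & S & tree.

Fixpoint nodes t := if t is Br t c u then (nodes t + nodes u).+1 else 0.

(** The words read from the root to all nodes, inner ones included. Inner nodes only add prefixes,
    which longer patterns imply, but they let the current node of a traversal be expressed by
    membership. *)
Fixpoint paths t : seq (seq S) :=
  if t is Br t c u then paths t ++ map (cons c) (paths u) else [:: [::]].

Lemma nil_in_paths t : [::] \in paths t.
Proof. by elim: t => //= t IH c u _; rewrite mem_cat IH. Qed.

Definition matches_all w t := all (pmatch^~ w) (paths t).

Lemma matches_allBr w t c u : matches_all w (Br t c u) =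
  matches_all w t && some_suffix (fun w' => (ohead w' == Some c) && matches_all w' u) w.
Proof.
rewrite /matches_all all_cat some_suffix_all ?all_map //.
by have := nil_in_paths u; case: (paths u).
Qed.

(** * Trees and formula sizes *)

(** [Some c] is a letter conjunct outside every [F]: it constrains the first position. *)
Definition root_ok r w := if r is Some c then ohead w == Some c else true.

(** Formula size plus one. With a root letter the size is [3 * nodes t + 1]; without one, the first
    branch needs no [LAnd] and the size is [3 * nodes t - 1]. The shift by one avoids the
    subtraction. *)
Definition weight r t := 3 * nodes t + (if r is Some _ then 2 else 0).

Fixpoint form_at c t : ltlFA S :=
  if t is Br t d u then LAnd (form_at c t) (LF (form_at d u)) else LAtom c.

Lemma fsize_form_at c t : fsize (form_at c t) = (3 * nodes t).+1.
Proof. by elim: t c => //= t IHt d u IHu c; rewrite IHt IHu; lia. Qed.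

Lemma satb_form_at c t w : satb w (form_at c t) = (ohead w == Some c) && matches_all w t.
Proof.
elim: t c w => [|t IHt d u IHu] c w; first by rewrite /matches_all /= andbT.
by rewrite /= IHt matches_allBr andbA; congr (_ && _); apply: eq_some_suffix.
Qed.

Fixpoint form_noroot t d u : ltlFA S :=
  if t is Br t' d' u' then LAnd (form_noroot t' d' u') (LF (form_at d u))
  else LF (form_at d u).

Lemma fsize_form_noroot t d u : (fsize (form_noroot t d u)).+1 = 3 * nodes (Br t d u).
Proof.
elim: t d u => [|t IH d' u' _] d u /=; first by rewrite fsize_form_at; lia.
by have := IH d' u'; rewrite fsize_form_at /=; lia.
Qed.

Lemma satb_form_noroot t d u w : satb w (form_noroot t d u) = matches_all w (Br t d u).
Proof.
have E d' u' : some_suffix (satb^~ (form_at d' u')) w =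
    some_suffix (fun w' => (ohead w' == Some d') && matches_all w' u') w.
  by apply: eq_some_suffix => w'; rewrite satb_form_at.
by elim: t d u => [|t IH d' u' _] d u; rewrite matches_allBr /= E // IH.
Qed.

Lemma tree_form r t : r != None \/ t <> Leaf ->
  exists phi, (fsize phi).+1 = weight r t /\
    forall w, satb w phi = root_ok r w && matches_all w t.
Proof.
rewrite /weight; case: r => [c _|].
  exists (form_at c t); rewrite fsize_form_at; split; first lia.
  exact: satb_form_at.
case: t => [[]//|t d u _]; exists (form_noroot t d u).
by rewrite fsize_form_noroot; split => [|w]; [lia|rewrite satb_form_noroot].
Qed.

Fixpoint tcat t t' := if t' is Br t' d u then Br (tcat t t') d u else t.

Lemma nodes_tcat t t' : nodes (tcat t t') = nodes t + nodes t'.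
Proof. by elim: t' => [|t' IH d u _] /=; rewrite ?IH; lia. Qed.

Lemma matches_all_tcat w t t' :
  matches_all w (tcat t t') = matches_all w t && matches_all w t'.
Proof.
elim: t' => [|t' IH d u _]; first by rewrite andbT.
by rewrite /= !matches_allBr IH andbA.
Qed.

(** A conjunction merges the two trees at the root, and two distinct root letters make it
    unsatisfiable. [F] turns a root letter into a branch; without a root letter it is absorbed,
    because what remains is monotone in the position. *)
Lemma form_tree phi : (forall w, satb w phi = false) \/
  exists r t, [/\ r != None \/ t <> Leaf, weight r t <= (fsize phi).+1 &
    forall w, satb w phi = root_ok r w && matches_all w t].
Proof.
rewrite /weight; elim: phi => [c|a IHa b IHb|a IHa] /=.
- by right; exists (Some c), Leaf; split=> // [|w]; [left|rewrite andbT].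
- case: IHa => [Ha|[r1 [t1 [N1 W1 E1]]]]; first by left => w; rewrite Ha.
  case: IHb => [Hb|[r2 [t2 [N2 W2 E2]]]]; first by left => w; rewrite Hb andbF.
  case: r1 r2 N1 W1 E1 N2 W2 E2 => [c1|] [c2|] N1 W1 E1 N2 W2 E2.
  + case: (eqVneq c1 c2) => [Ec|/eqP Ec]; last first.
      left=> w; rewrite E1 E2 /=; case: eqP => //= ->.
      by case: eqP => [[//]|_]; rewrite andbF.
    right; exists (Some c1), (tcat t1 t2); rewrite nodes_tcat; split=> [||w]; first by left.
      lia.
    by rewrite E1 E2 matches_all_tcat /= Ec; case: eqP.
  + right; exists (Some c1), (tcat t1 t2); rewrite nodes_tcat; split=> [||w]; first by left.
      lia.
    by rewrite E1 E2 matches_all_tcat /= andbA.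
  + right; exists (Some c2), (tcat t1 t2); rewrite nodes_tcat; split=> [||w]; first by left.
      lia.
    by rewrite E1 E2 matches_all_tcat /= andbCA.
  + right; exists None, (tcat t1 t2); rewrite nodes_tcat; split=> [||w].
    * by right; case: N2 => //; case: t2 {W2 E2}.
    * lia.
    * by rewrite E1 E2 matches_all_tcat.
- case: IHa => [Ha|[r [t [N W E]]]]; [left|right; case: r N W E => [c|] N W E].
  + by move=> w; apply/negP => /some_suffixP[j _]; rewrite Ha.
  + exists None, (Br Leaf c t); split=> [||w] /=; [by right|lia|].
    by rewrite matches_allBr; apply: eq_some_suffix => w'; rewrite E.
  + exists None, t; split=> [//||w] /=; first lia.
    rewrite (eq_some_suffix _ E) /=; case: N => // N.
    case: t N {W E} => // t d u _; apply/some_suffixP/idP => [[j _ /allP H]|H].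
      by apply/allP => p /H/pmatch_drop.
    (* Position 0 exists: the tree is not a leaf, so the empty word fails one of its patterns. *)
    exists 0; rewrite ?drop0 //; case: w H => //.
    by rewrite matches_allBr andbF.
Qed.

(** * Traversals and their accounting *)

Lemma paths_prefix t p c : rcons p c \in paths t -> p \in paths t.
Proof.
elim: t p => [|t IHt d u IHu] p /=; first by rewrite inE; case: p.
rewrite !mem_cat => /orP[/IHt->//|/mapP[q Hq]].
case: p => [_|d' p [-> E]]; first by rewrite nil_in_paths.
by rewrite map_f ?orbT // IHu ?E.
Qed.

(** One node always suffices, and one is always added, even when the extended path is already
    present: a traversal that enters the same child twice pays twice. Only the set of paths matters,
    hence [=i]. *)
Lemma paths_insert t p c : p \in paths t ->
  exists t', nodes t' = (nodes t).+1 /\ paths t' =i rcons p c :: paths t.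
Proof.
have base t1 : exists t', nodes t' = (nodes t1).+1 /\ paths t' =i [:: c] :: paths t1.
  exists (Br t1 c Leaf); split=> [|q] /=; first lia.
  by rewrite mem_cat inE /= inE orbC.
elim: t p => [|t IHt d u IHu] p /=; first by rewrite inE => /eqP->; exact: (base Leaf).
rewrite mem_cat => /orP[/IHt[t' [N P]]|/mapP[q /IHu[u' [N P]] ->]].
  exists (Br t' d u) => /=; split=> [|q]; first by rewrite N.
  by rewrite inE !mem_cat P inE orbA.
exists (Br t d u') => /=; split=> [|q']; first by rewrite N; lia.
rewrite inE !mem_cat orbCA; congr (_ || _).
apply/mapP/orP => [[q1]|[/eqP->|/mapP[q1 Hq ->]]].
- rewrite P inE => /orP[/eqP-> ->|Hq ->]; first by left.
  by right; apply: map_f.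
- by exists (rcons q c); rewrite // P inE eqxx.
- by exists q1; rewrite // P inE Hq orbT.
Qed.

(* A certificate is a depth-first traversal of a tree: [pr] is the reversed path
   to the current node, [vs] are the negative words not yet rejected by a visited
   path and [b] is the remaining size budget. *)
Definition astate : Type := (seq S * seq (seq S) * nat)%type.

Definition rmatch r pr w := root_ok r w && pmatch (rev pr) w.

Definition aenter us r pr n (vs : seq (seq S)) b : option astate :=
  if (n <= b) && all (rmatch r pr) us then Some (pr, filter (rmatch r pr) vs, b - n)
  else None.

Definition astep us r (o : option S) (st : astate) : option astate :=
  let: (pr, vs, b) := st in
  match o with
  | Some c => aenter us r (c :: pr) 3 vs b
  | None => if pr is _ :: pr' then Some (pr', vs, b) else None
  end.

Fixpoint arun us r (os : seq (option S)) st : option astate :=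
  if os is o :: os' then obind (arun us r os') (astep us r o st) else Some st.

Definition aroot (s : bool * S) := if s.1 then Some s.2 else None.

(** The Boolean tells whether the formula has a root letter, of price 1. Otherwise the first pattern
    letter costs 2 rather than 3, for [LF] and the letter, as the first conjunct needs no [LAnd]. *)
Definition astart us (s : bool * S) vs k : option astate :=
  if s.1 then aenter us (aroot s) [::] 1 vs k
  else aenter us (aroot s) [:: s.2] 2 vs k.

Lemma arun_cat us r os1 os2 st :
  arun us r (os1 ++ os2) st = obind (arun us r os2) (arun us r os1 st).
Proof. by elim: os1 st => //= o os IH st; case: (astep _ _ _ _). Qed.

(** * Soundness of traversals *)

Section Sound.
Variables (us vs0 : seq (seq S)) (k : nat) (r : option S).

(** The tree [t] collects all nodes visited so far, and what has been spent pays for its weight; the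
    bound is [k.+1] because [weight] is the size plus one. A negative word missing from [vs] is
    already rejected by [t]. *)
Definition ainv (st : astate) := let: (pr, vs, b) := st in exists t,
  [/\ r != None \/ t <> Leaf, rev pr \in paths t, weight r t + b <= k.+1,
      forall w, w \in us -> root_ok r w && matches_all w t &
      forall v, v \in vs0 -> v \in vs \/ ~~ (root_ok r v && matches_all v t)].

Lemma ainv_enter t p c n vs b st : p \in paths t -> 3 <= n ->
  weight r t + b <= k.+1 ->
  (forall w, w \in us -> root_ok r w && matches_all w t) ->
  (forall v, v \in vs0 -> v \in vs \/ ~~ (root_ok r v && matches_all v t)) ->
  aenter us r (c :: rev p) n vs b = Some st -> ainv st.
Proof.
move=> Hp Hn Hw Hu Hv; rewrite /aenter; case: ifP => // /andP[Hb /allP Hall] [<-].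
have [t' [N P]] := paths_insert c Hp.
(* The inserted path is the only new constraint on a word. *)
have E w : root_ok r w && matches_all w t' =
    rmatch r (c :: rev p) w && (root_ok r w && matches_all w t).
  rewrite /rmatch /matches_all (eq_all_r P) /= rev_cons revK.
  by case: (root_ok r w).
exists t'; split.
- by right; case: t' N {P E}.
- by rewrite rev_cons revK P inE eqxx.
- by move: Hw; rewrite /weight N; lia.
- by move=> w Hw'; rewrite E Hall ?Hu.
- move=> v /Hv[Hin|Hno]; rewrite ?mem_filter E.
    by rewrite Hin andbT; case: (rmatch _ _ _); [left|right].
  by right; rewrite (negPf Hno) andbF.
Qed.

Lemma ainv_step o st st' : astep us r o st = Some st' -> ainv st -> ainv st'.
Proof.
case: st => [[pr vs] b]; case: o => [c|] /=; last first.
  case: pr => // d pr [<-] [t [H1 H2 H3 H4 H5]]; exists t; split=> //.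
  by move: H2; rewrite rev_cons; apply: paths_prefix.
move=> H [t [H1 H2 H3 H4 H5]].
by apply: (ainv_enter H2 _ H3 H4 H5 (n := 3)); rewrite ?revK; first done; exact: H.
Qed.

Lemma ainv_run os st st' : arun us r os st = Some st' -> ainv st -> ainv st'.
Proof.
elim: os st => [|o os IH] st /=; first by case=> ->.
by case E: (astep _ _ _ _) => [st1|] //= /IH H /(ainv_step E).
Qed.

Lemma ainv_final pr b : ainv (pr, [::], b) -> exists phi,
  [/\ fsize phi <= k, forall w, w \in us -> satb w phi &
      forall v, v \in vs0 -> ~~ satb v phi].
Proof.
move=> [t [H1 H2 H3 H4 H5]]; have [phi [W E]] := tree_form H1.
exists phi; split=> [|w|v]; first lia.
- by rewrite E; apply: H4.
- by rewrite E => /H5[].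
Qed.
End Sound.

Lemma ainv_start us s vs k st : astart us s vs k = Some st -> ainv us vs k (aroot s) st.
Proof.
case: s => [[|] c]; rewrite /astart /aroot /=; last first.
  rewrite /aenter; case: ifP => // /andP[k2 /allP Hall] [<-].
  have E w : matches_all w (Br Leaf c Leaf) = rmatch None [:: c] w.
    by rewrite /matches_all /= andbT.
  exists (Br Leaf c Leaf); split=> [||||v Hv]; rewrite ?inE //.
  - by right.
  - exact: eqxx.
  - by rewrite /weight /=; lia.
  - by move=> w /Hall; rewrite E.
  - by rewrite E mem_filter Hv andbT; case: (rmatch _ _ _); [left|right].
rewrite /aenter; case: ifP => // /andP[k1 /allP Hall] [<-].
exists Leaf; split=> [||||v Hv]; rewrite ?inE //.
- by left.
- by rewrite /weight /=; lia.

- rewrite mem_filter Hv andbT /matches_all /rmatch /=.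
  by case: (ohead v == _); [left|right].
Qed.

Lemma arun_sound us s os vs k st pr b :
  astart us s vs k = Some st -> arun us (aroot s) os st = Some (pr, [::], b) ->
  exists phi, [/\ fsize phi <= k, forall w, w \in us -> satb w phi &
    forall v, v \in vs -> ~~ satb v phi].
Proof. by move=> /ainv_start I /ainv_run/(_ I)/ainv_final. Qed.

(** * Existence of short traversals *)

Section Complete.
Variables (us : seq (seq S)) (r : option S) (D : nat).

Definition extends_all pr t w := all (fun q => pmatch (rev pr ++ q) w) (paths t).

Lemma extends_allBr pr t c u w :
  extends_all pr (Br t c u) w = extends_all pr t w && extends_all (c :: pr) u w.
Proof.
rewrite /extends_all all_cat all_map; congr (_ && _); apply: eq_all => q /=.
by rewrite rev_cons cat_rcons.
Qed.

Lemma extends_all_prefix pr t w : extends_all pr t w -> pmatch (rev pr) w.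
Proof. by move/allP/(_ _ (nil_in_paths t)); rewrite cats0. Qed.

(** In the length bound, every negative word rejected within [t] pays two moves for each of the
    [D - size pr] depths still available. The depth stays below [D] because the current path has no
    equal neighbours and matches a positive word of length at most [D]. Skipped branches leave
    budget over, so the budget is only bounded from below. *)
Lemma dfs_run t pr vs b :
  sorted (fun x y => x != y) pr ->
  (vs != [::] -> exists2 w, w \in us & size w <= D) ->
  (forall w, w \in us -> root_ok r w && extends_all pr t w) ->
  all (rmatch r pr) vs -> 3 * nodes t <= b ->
  exists os b', [/\ arun us r os (pr, vs, b) = Some (pr, filter (extends_all pr t) vs, b'),
    b <= b' + 3 * nodes t &
    size os <= 2 * (D - size pr) * (size vs - size (filter (extends_all pr t) vs))].
Proof.
elim: t pr vs b => [|t IHt c u IHu] pr vs b srt HD Hus Hvs Hb.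
  exists [::], b; split=> //=; last by lia.
  congr (Some (_, _, _)); apply/esym/all_filterP; apply: sub_all Hvs => v /andP[_].
  by rewrite /extends_all /= cats0 andbT.
have {}Hus w : w \in us ->
    [/\ root_ok r w, extends_all pr t w & extends_all (c :: pr) u w].
  by move/Hus; rewrite extends_allBr => /and3P[].
rewrite /= in Hb.
have [||os1 [b1 [R1 B1 L1]]] := IHt pr vs b srt HD _ Hvs.
- by move=> w /Hus[-> ->].
- lia.
set vs1 := filter _ vs in R1 L1.
have F : filter (extends_all pr (Br t c u)) vs = filter (extends_all (c :: pr) u) vs1.
  rewrite -filter_predI; apply: eq_filter => v /=.
  by rewrite extends_allBr andbC.
have Hvs1 : all (rmatch r pr) vs1 by rewrite all_filter; apply: sub_all Hvs => v /= ->;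
    rewrite implybT.
have Lvs1 : size vs1 <= size vs by rewrite size_filter count_size.
rewrite F.
(* When no surviving word is rejected below [c], the branch is skipped; otherwise it rejects at
   least one word, which will pay for entering it. *)
have [A|nA] := boolP (all (extends_all (c :: pr) u) vs1).
  by exists os1, b1; rewrite (all_filterP A); split=> //=; lia.
have HD1 : vs1 != [::] -> exists2 w, w \in us & size w <= D.
  by move=> H; apply: HD; apply: contraNneq H => E; rewrite /vs1 E.
have [w0 w0us w0D] : exists2 w, w \in us & size w <= D.
  by apply: HD1; apply: contraNneq nA => ->.
set fin := filter _ vs1; have Lfin : size fin < size vs1.
  rewrite size_filter ltn_neqAle count_size andbT.
  by apply: contraNneq nA; rewrite all_count => ->.
(* A branch that repeats the last letter of the path is explored from the current node without
   moving, so [pr] keeps distinct neighbours. *)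
have [Hc|Hc] := boolP (ohead pr == Some c).
  have E : extends_all (c :: pr) u =1 extends_all pr u.
    case: pr Hc {F vs1 fin R1 L1 Hvs1 Lvs1 HD1 nA Lfin srt Hvs Hus} => // _ pr /eqP[->] w.
    by apply: eq_all => q; rewrite !rev_cons cat_rcons pmatch_stutter.
  have [||os2 [b2 [R2 B2 L2]]] := IHu pr vs1 b1 srt HD1 _ Hvs1.
  - by move=> w /Hus[-> _]; rewrite E => ->.
  - lia.
  rewrite -(eq_filter E) -/fin in R2 L2.
  exists (os1 ++ os2), b2; split; [by rewrite arun_cat R1 /= R2|rewrite /=; lia|].
  rewrite size_cat; apply: leq_trans (leq_add L1 L2) _.
  by rewrite -mulnDr leq_mul2l addnBA ?subnK ?leqnn ?orbT // ltnW.
have srt' : sorted (fun x y => x != y) (c :: pr).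
  by case: pr Hc srt {F vs1 fin R1 L1 Hvs1 Lvs1 HD1 nA Lfin Hvs Hus} => //= d pr;
      rewrite (inj_eq Some_inj) eq_sym => -> ->.
have lD : size pr < D.
  have [_ _ /extends_all_prefix M] := Hus _ w0us.
  rewrite -[_.+1]/(size (c :: pr)) -size_rev; apply: leq_trans w0D.
  apply: pmatch_size M; rewrite rev_sorted.
  by rewrite (eq_sorted (e' := fun x y => x != y)) // => x y; rewrite eq_sym.
set vs2 := filter (rmatch r (c :: pr)) vs1.
have E2 : filter (extends_all (c :: pr) u) vs2 = fin.
  rewrite -filter_predI; apply: eq_in_filter => v /(allP Hvs1)/andP[rv _] /=.
  by rewrite /rmatch rv /=; apply: andb_idr => /extends_all_prefix.
have [||||os2 [b2 [R2 B2 L2]]] := IHu (c :: pr) vs2 (b1 - 3) srt'.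
- by move=> H; apply: HD1; apply: contraNneq H => E; rewrite /vs2 E.
- by move=> w /Hus[-> _ ->].
- by rewrite /vs2; apply: filter_all.
- lia.
rewrite E2 /= in R2 L2.
exists (os1 ++ (Some c :: os2) ++ [:: None]), b2; split.
  rewrite arun_cat R1 /= /aenter ifT /= ?arun_cat ?R2 //.
  apply/andP; split; first lia.
  by apply/allP => w /Hus[rw _ /extends_all_prefix M]; rewrite /rmatch rw.
- rewrite /=; lia.
- have Lvs2 : size vs2 <= size vs1 by rewrite size_filter count_size.
  rewrite !size_cat /= addn1.
  (* Descending lowers the depth factor by one; since at least one word is rejected in the branch,
     this frees the two moves down and back. *)
  have X : 2 * (D - (size pr).+1) * (size vs2 - size fin) + 2 <= 2 * (D - size pr) * (size vs1 -
      size fin).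
    have Ez : D - size pr = (D - (size pr).+1).+1 by lia.
    have Ey : size vs1 - size fin = (size vs1 - (size fin).+1).+1 by lia.
    rewrite Ez Ey; set z := D - _; set y := size vs1 - _; set g := size vs2 - _.
    have : g <= y.+1 by rewrite /g /y; lia.
    by move=> *; nia.
  have Y : size os2 + 2 <= 2 * (D - size pr) * (size vs1 - size fin).
    by apply: leq_trans X; rewrite leq_add2r.
  have Z := leq_add L1 Y; rewrite -mulnDr in Z.
  rewrite -[(size os2).+2]addn2; apply: (leq_trans Z).
  by rewrite leq_mul2l addnBA ?subnK ?leqnn ?orbT // ltnW.
Qed.
End Complete.

(** The constant 4 and the [+ 1] come from formulas without a root letter: the traversal starts
    inside one branch, climbs back by one move, then explores the other branches, and each of the
    two runs takes at most [2 * D * size vs] moves. *)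
Lemma arun_complete us vs k D phi :
  (vs != [::] -> exists2 w, w \in us & size w <= D) -> S ->
  (us == [::] -> vs == [::]) ->
  fsize phi <= k ->
  (forall w, w \in us -> satb w phi) -> (forall v, v \in vs -> ~~ satb v phi) ->
  exists s st os pr b, [/\ astart us s vs k = Some st,
    arun us (aroot s) os st = Some (pr, [::], b) & size os <= 4 * D * size vs + 1].
Proof.
move=> HD c0 Hus Hk Pos Neg.
have [phi' [Hk' Pos' Neg' [r [t [N W E]]]]] : exists phi', [/\ fsize phi' <= k,
    forall w, w \in us -> satb w phi', forall v, v \in vs -> ~~ satb v phi' &
    exists r t, [/\ r != None \/ t <> Leaf, weight r t <= (fsize phi').+1 &
    forall w, satb w phi' = root_ok r w && matches_all w t]].
  have [F|H] := form_tree phi; last by exists phi.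
  (* An unsatisfiable formula leaves no positive word, hence no negative one, and then a single
     letter separates; it fits the budget because every formula has size at least 1. *)
  exists (LAtom c0); have U : us = [::].
    by case: (us) Pos => // w us' /(_ w); rewrite inE eqxx F => /(_ isT).
  have V : vs = [::] by apply/eqP/Hus; rewrite U.
  rewrite U V; split=> //; first by apply: leq_trans Hk; case: (phi).
  exists (Some c0), Leaf; split=> // [|w]; first by left.
  by rewrite /= andbT.
have {}Pos' w : w \in us -> root_ok r w && extends_all [::] t w by rewrite -E; apply: Pos'.
have {}Neg' v : v \in vs -> ~~ (root_ok r v && extends_all [::] t v) by rewrite -E; apply: Neg'.
have {Hk}Wk : weight r t <= k.+1 by apply: leq_trans W _.
have Dfil (P : pred (seq S)) : filter P vs != [::] -> exists2 w, w \in us & size w <= D.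
  by move=> H; apply: HD; apply: contraNneq H => ->.
case: r N W E Pos' Neg' Wk => [c|] N W E Pos' Neg' Wk; rewrite /weight in Wk.
  have [|||||os [b [R _ L]]] := @dfs_run us (Some c) D t [::] (filter (rmatch (Some c) [::]) vs)
      (k - 1).
  - by [].
  - exact: Dfil.
  - by [].
  - exact: filter_all.
  - lia.
  exists (true, c), ([::], filter (rmatch (Some c) [::]) vs, k - 1), os, [::], b.
  rewrite /astart /= /aenter ifT; last first.
    rewrite (leq_trans _ (_ : fsize phi' <= k)) //; last by case: (phi').
    by apply/allP => w /Pos'/andP[rw _]; rewrite /rmatch rw.
  have F0 : filter (extends_all [::] t) (filter (rmatch (Some c) [::]) vs) = [::].
    apply/eqP; rewrite -filter_predI -size_eq0 size_filter -leqn0 leqNgt -has_count.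
    by apply/hasPn => v /Neg'; rewrite /= /rmatch /= andbT andbC.
  split=> //; first by rewrite R F0.
  rewrite (leq_trans L) // subn0; apply: (@leq_trans (2 * D * size vs)); last by lia.
  by rewrite leq_mul2l; apply/orP; right;
      rewrite (leq_trans (leq_subr _ _)) // size_filter count_size.
case: t N W E Pos' Neg' Wk => [|t c u] N W E Pos' Neg' Wk; first by case: N.
rewrite /= in Wk Pos' Neg'.
set vs1 := filter (rmatch None [:: c]) vs.
have {}Pos' w : w \in us -> extends_all [::] t w /\ extends_all [:: c] u w.
  by move/Pos'; rewrite extends_allBr => /andP.
have [|||||os1 [b1 [R1 B1 L1]]] := @dfs_run us None D u [:: c] vs1 (k - 2).
- by [].
- exact: Dfil.
- by move=> w /Pos'[_ ->].
- exact: filter_all.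
- lia.
set vs2 := filter _ vs1 in R1 L1.
have [|||||os2 [b2 [R2 B2 L2]]] := @dfs_run us None D t [::] vs2 b1.
- by [].
- by rewrite /vs2 /vs1 -filter_predI; exact: Dfil.
- by move=> w /Pos'[].
- exact/allP.
- lia.
have F0 : filter (extends_all [::] t) vs2 = [::].
  apply/eqP; rewrite -!filter_predI -size_eq0 size_filter -leqn0 leqNgt -has_count.
  apply/hasPn => v /Neg'; rewrite extends_allBr /=; apply: contra.
  by case: (extends_all [::] t v); case: (extends_all [:: c] u v); rewrite ?andbF.
exists (false, c), ([:: c], vs1, k - 2), (os1 ++ None :: os2), [::], b2; split.
- rewrite /astart /= /aenter ifT //; apply/andP; split; first lia.
  by apply/allP => w /Pos'[_ /extends_all_prefix].
- by rewrite arun_cat R1 /= R2 F0.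
- rewrite size_cat /=.
  have S1 : size vs1 <= size vs by rewrite size_filter count_size.
  have S2 : size vs2 <= size vs1 by rewrite size_filter count_size.
  have X1 : size os1 <= 2 * D * size vs.
    by rewrite (leq_trans L1) // leq_mul //; [rewrite leq_mul2l leq_subr|lia].
  have X2 : size os2 <= 2 * D * size vs.
    by rewrite (leq_trans L2) // leq_mul //; [rewrite leq_mul2l leq_subr|lia].
  lia.
Qed.
End Patterns.

(** * While-programs over stacks and their simulation *)

Section StackMachine.
Variables (G : finType) (k' : nat).
Notation k := k'.+1.
Notation store := (seq (seq G)).

Inductive act := APush of 'I_k & G | APop of 'I_k | ANop.

Definition upd (s : store) (i : nat) l : store := set_nth [::] s i l.

Definition doact ac (s : store) : store :=
  match ac with
  | APush j g => upd s j (g :: nth [::] s j)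
  | APop j => upd s j (behead (nth [::] s j))
  | ANop => s
  end.

Definition tops (s : store) : seq (option G) := map ohead s.

(** Guards and actions see only the tops of the stacks, a finite amount of data, so the control of a
    program fits into a finite set of states. *)
Inductive com :=
| Act of seq (option G) -> act
| Seq of com & com
| If of pred (seq (option G)) & com & com
| While of pred (seq (option G)) & com
| Abort.

(** Computed as a finite type so that program points can be machine states; [None] is the test of a
    conditional or of a loop. *)
Fixpoint points (c : com) : finType :=
  match c with
  | Act _ | Abort => unit
  | Seq a b => (points a + points b)%type
  | If _ a b => option (points a + points b)
  | While _ a => option (points a)
  end.

Fixpoint start (c : com) : points c :=
  match c return points c with
  | Act _ | Abort => tt
  | Seq a b => inl (start a)
  | If _ a b => None
  | While _ a => None
  end.

(* Exits are [inr true] (normal termination) and [inr false] (abort). *)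
Fixpoint cstep (c : com) : points c -> seq (option G) -> (points c + bool) * act :=
  match c return points c -> seq (option G) -> (points c + bool) * act with
  | Act f => fun _ tp => (inr true, f tp)
  | Abort => fun _ _ => (inr false, ANop)
  | Seq a b => fun q tp =>
    match q with
    | inl q => let: (r, ac) := cstep q tp in
      (match r with inl q' => inl (inl q') | inr true => inl (inr (start b))
                  | inr false => inr false end, ac)
    | inr q => let: (r, ac) := cstep q tp in
      (match r with inl q' => inl (inr q') | inr e => inr e end, ac)
    end
  | If p a b => fun q tp =>
    match q with
    | None => (inl (Some (if p tp then inl (start a) else inr (start b))), ANop)
    | Some (inl q) => let: (r, ac) := cstep q tp in
      (match r with inl q' => inl (Some (inl q')) | inr e => inr e end, ac)
    | Some (inr q) => let: (r, ac) := cstep q tp in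
      (match r with inl q' => inl (Some (inr q')) | inr e => inr e end, ac)
    end
  | While p a => fun q tp =>
    match q with
    | None => (if p tp then inl (Some (start a)) else inr true, ANop)
    | Some q => let: (r, ac) := cstep q tp in
      (match r with inl q' => inl (Some q') | inr true => inl None
                  | inr false => inr false end, ac)
    end
  end.

(** * Timed executions of programs *)

Inductive reach (c : com) : points c + bool -> store -> points c + bool -> store -> nat -> Prop :=
| reach0 r s : reach r s r s 0
| reachS q s r1 ac r s' t : cstep q (tops s) = (r1, ac) ->
    reach r1 (doact ac s) r s' t -> reach (inl q) s r s' t.+1.

Lemma reach_trans c (q r r' : points c + bool) s s1 s2 t1 t2 :
  reach q s r s1 t1 -> reach r s1 r' s2 t2 -> reach q s r' s2 (t1 + t2).
Proof.
elim=> // {q s r s1 t1} q s r1 ac r s1 t1 E _ IH H.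
exact: reachS E (IH H).
Qed.

(** A run of a subprogram is a run of the enclosing program once points are renamed by [g] and exits
    redirected by [f]; this serves all constructors of [com]. *)
Lemma reach_lift c d (f : points c + bool -> points d + bool) (g : points c -> points d) q s r s'
    t :
  (forall q, f (inl q) = inl (g q)) ->
  (forall q tp, cstep (g q) tp = (f (cstep q tp).1, (cstep q tp).2)) ->
  reach q s r s' t -> reach (f q) s (f r) s' t.
Proof.
move=> fg H; elim=> [r1 s1|q1 s1 r1 ac r2 s2 t1 E _ IH]; first exact: reach0.
by rewrite fg; apply: reachS IH; rewrite H E.
Qed.

(* [None] is an aborted run; [T] is an upper bound on the number of steps. *)
Definition exec c s (o : option store) T := exists t s',
  [/\ t <= T, reach (inl (start c)) s (inr (isSome o)) s' t & forall s1, o = Some s1 -> s' = s1].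

Lemma exec_le c s o T T' : exec c s o T -> T <= T' -> exec c s o T'.
Proof. by move=> [t [s' [H1 H2 H3]]] H; exists t, s'; split=> //; apply: leq_trans H. Qed.

Lemma exec_act f s : exec (Act f) s (Some (doact (f (tops s)) s)) 1.
Proof.
exists 1, (doact (f (tops s)) s); split=> // [|s1 [//]].
by apply: reachS; [reflexivity|exact: reach0].
Qed.

Lemma exec_abort s : exec Abort s None 1.
Proof. by exists 1, s; split=> //; apply: reachS; [reflexivity|exact: reach0]. Qed.

Lemma exec_seq a b s s1 o t1 t2 :
  exec a s (Some s1) t1 -> exec b s1 o t2 -> exec (Seq a b) s o (t1 + t2).
Proof.
move=> [n1 [s1' [L1 R1 /(_ _ erefl) E1]]] [n2 [s2 [L2 R2 E2]]]; subst s1'.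
exists (n1 + n2), s2; split=> //; first exact: leq_add.
pose fl (r : points a + bool) : points (Seq a b) + bool :=
  match r with inl q' => inl (inl q') | inr true => inl (inr (start b))
                  | inr false => inr false end.
pose fr (r : points b + bool) : points (Seq a b) + bool :=
  match r with inl q' => inl (inr q') | inr e => inr e end.
apply: (reach_trans (reach_lift (f := fl) (g := inl) _ _ R1) (reach_lift (f := fr) (g := inr) _ _
    R2)) => // q tp /=; by case: (cstep q tp).
Qed.

Lemma exec_seq_abort a b s t : exec a s None t -> exec (Seq a b) s None t.
Proof.
move=> [n1 [s1' [L1 R1 _]]]; exists n1, s1'; split=> //.
pose fl (r : points a + bool) : points (Seq a b) + bool :=
  match r with inl q' => inl (inl q') | inr true => inl (inr (start b))
                  | inr false => inr false end.
by apply: (reach_lift (f := fl) (g := inl) _ _ R1) => // q tp /=; case: (cstep q tp).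
Qed.

Lemma exec_if (p : pred (seq (option G))) a b s o t :
  exec (if p (tops s) then a else b) s o t -> exec (If p a b) s o t.+1.
Proof.
pose fl (r : points a + bool) : points (If p a b) + bool :=
  match r with inl q' => inl (Some (inl q')) | inr e => inr e end.
pose fr (r : points b + bool) : points (If p a b) + bool :=
  match r with inl q' => inl (Some (inr q')) | inr e => inr e end.
case: ifP => E [n1 [s1 [L1 R1 E1]]]; exists n1.+1, s1; split=> //.
  apply: (@reachS (If p a b) None _ (inl (Some (inl (start a)))) ANop); first by rewrite /= E.
  by apply: (reach_lift (f := fl) (g := Some \o inl) _ _ R1) => // q tp /=; case: (cstep q tp).
apply: (@reachS (If p a b) None _ (inl (Some (inr (start b)))) ANop); first by rewrite /= E.
by apply: (reach_lift (f := fr) (g := Some \o inr) _ _ R1) => // q tp /=; case: (cstep q tp).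
Qed.

Lemma exec_while_end (p : pred (seq (option G))) a s : ~~ p (tops s) ->
  exec (While p a) s (Some s) 1.
Proof.
move=> H; exists 1, s; split=> // [|s1 [//]].
by apply: (@reachS (While p a) None _ (inr true) ANop); [rewrite /= (negPf H)|exact: reach0].
Qed.

Lemma exec_while (p : pred (seq (option G))) a s s1 o t1 t2 : p (tops s) ->
  exec a s (Some s1) t1 -> exec (While p a) s1 o t2 -> exec (While p a) s o (t1 + t2).+1.
Proof.
move=> H [n1 [s1' [L1 R1 /(_ _ erefl) E1]]] [n2 [s2 [L2 R2 E2]]]; subst s1'.
exists (n1 + n2).+1, s2; split=> //; first exact: leq_add.
pose f (r : points a + bool) : points (While p a) + bool :=
  match r with inl q' => inl (Some q') | inr true => inl None
                  | inr false => inr false end.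
apply: (@reachS (While p a) None _ (inl (Some (start a))) ANop); first by rewrite /= H.
apply: reach_trans R2.
by apply: (reach_lift (f := f) (g := Some) _ _ R1) => // q tp /=; case: (cstep q tp).
Qed.

Lemma exec_while_abort (p : pred (seq (option G))) a s t1 : p (tops s) ->
  exec a s None t1 -> exec (While p a) s None t1.+1.
Proof.
move=> H [n1 [s1 [L1 R1 _]]]; exists n1.+1, s1; split=> //.
pose f (r : points a + bool) : points (While p a) + bool :=
  match r with inl q' => inl (Some q') | inr true => inl None
                  | inr false => inr false end.
apply: (@reachS (While p a) None _ (inl (Some (start a))) ANop); first by rewrite /= H.
by apply: (reach_lift (f := f) (g := Some) _ _ R1) => // q tp /=; case: (cstep q tp).
Qed.

(** * Simulation on a single tape *)

Section Compile.
Variables (A : Type) (inj : A -> G) (c : com).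

(* Tape cell [i], counted from the initial head position, holds the [i]-th
   elements of all the stacks; the Boolean flags cell 0. *)
Definition sym : finType := (bool * k.-tuple (option G))%type.

Definition setc (x : sym) (j : 'I_k) (o : option G) : sym :=
  (x.1, [tuple if i == j then o else tnth x.2 i | i < k]).

(* Sweeps: return to the flagged cell; push, carrying a symbol to the right; pop,
   moving to the end of the stack; pop, carrying a symbol to the left. *)
Definition sweep : finType := (unit + 'I_k * G + ('I_k + 'I_k * option G))%type.

Definition ctl : finType := (points c + bool)%type.

(* [None] is the initial state, in which cell 0 gets flagged. *)
Definition tstate : finType := option (ctl * option sweep).

Definition sw_ret : sweep := inl (inl tt).
Definition sw_push j g : sweep := inl (inr (j, g)).
Definition sw_end j : sweep := inr (inl j).
Definition sw_pop j o : sweep := inr (inr (j, o)).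

Definition sweep_of ac : option sweep :=
  match ac with APush j g => Some (sw_push j g) | APop j => Some (sw_end j) | ANop => None end.

Definition delta_ctl (q : ctl) (x : sym) : tstate * sym * move :=
  match q with
  | inl p => (Some ((cstep p (tval x.2)).1, sweep_of (cstep p (tval x.2)).2), x, MStay)
  | inr _ => (Some (q, None), x, MStay)
  end.

Definition delta_sweep (q : ctl) (w : sweep) (x : sym) : tstate * sym * move :=
  match w with
  | inl (inl _) => if x.1 then (Some (q, None), x, MStay) else (Some (q, Some w), x, MLeft)
  | inl (inr (j, g)) =>
      if tnth x.2 j is Some g' then (Some (q, Some (sw_push j g')), setc x j (Some g), MRight)
      else (Some (q, Some sw_ret), setc x j (Some g), MStay)
  | inr (inl j) =>
      if tnth x.2 j is Some _ then (Some (q, Some w), x, MRight)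
      else (Some (q, Some (sw_pop j None)), x, MStay)
  | inr (inr (j, o)) =>
      if x.1 then (Some (q, None), setc x j o, MStay)
      else (Some (q, Some (sw_pop j (tnth x.2 j))), setc x j o, MLeft)
  end.

Definition delta (q : tstate) (x : sym) : tstate * sym * move :=
  match q with
  | None => (Some (inl (start c), None), (true, x.2), MStay)
  | Some (q, None) => delta_ctl q x
  | Some (q, Some w) => delta_sweep q w x
  end.

Definition machine : TM A := {|
  tm_state := tstate;
  tm_sym := sym;
  tm_blank := (false, [tuple None | i < k]);
  tm_input := fun a => (false, [tuple if i == ord0 then Some (inj a) else None | i < k]);
  tm_start := None;
  tm_acc := pred1 (Some (inr true, None));
  tm_rej := pred1 (Some (inr false, None));
  tm_delta := delta |}.

(** The tape is viewed as a function of the absolute position, with the initial cell as origin. The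
    head never goes left of it, so its position is the size of [L]. *)
Definition rep (cf : cfg machine) (q : tstate) (p : nat) (T : nat -> sym) : Prop :=
  let: (q', L, R) := cf in [/\ q' = q, size L = p &
    forall i, nth (tm_blank machine) (catrev L R) i = T i].

Definition halted (q : tstate) := (q == Some (inr true, None)) || (q == Some (inr false, None)).

Definition moved (m : move) p := match m with MStay => p | MRight => p.+1 | MLeft => p.-1 end.

Lemma nth_catrev_write (X : Type) (x b : X) L R i :
  nth x (catrev L (b :: behead R)) i = if i == size L then b else nth x (catrev L R) i.
Proof.
rewrite !catrevE !nth_cat !size_rev; case: ltngtP => // [lt|->]; last by rewrite subnn.
have -> : i - size L = (i - size L).-1.+1 by lia.
by rewrite /= nth_behead.
Qed.

Lemma rep_step cf q p T q' b m : rep cf q p T -> ~~ halted q ->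
  delta q (T p) = (q', b, m) -> (if m is MLeft then 0 < p else true) ->
  rep (tm_step cf) q' (moved m p) (fun i => if i == p then b else T i).
Proof.
case: cf => [[q0 L] R] [-> Lp ET] nh D Hm.
have hR : head (tm_blank machine) R = T p.
  by rewrite -ET catrevE nth_cat size_rev Lp ltnn subnn nth0.
have W i : nth (tm_blank machine) (catrev L (b :: behead R)) i = if i == p then b else T i.
  by rewrite nth_catrev_write Lp ET.
rewrite /tm_step; rewrite /halted in nh; rewrite /= (negPf nh).
rewrite [head _ _]hR D; case: m Hm {D} => Hm /=; split=> //; rewrite ?Lp //.
  by rewrite size_behead Lp.
by case: L Lp {ET} W => [|a L] //= Lp; rewrite -Lp in Hm.
Qed.

Definition tape (s : store) i : sym :=
  (i == 0, [tuple onth (nth [::] s (val j)) i | j < k]).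

Definition runs n cf q p T := exists2 m, m <= n & rep (iter m (@tm_step _ machine) cf) q p T.

Lemma halted_sweep q w : ~~ halted (Some (q, Some w)).
Proof. by rewrite /halted !(inj_eq Some_inj) !xpair_eqE !andbF. Qed.

Lemma halted_ctl p o : ~~ halted (Some (inl p, o)).
Proof. by rewrite /halted !(inj_eq Some_inj) !xpair_eqE. Qed.

Lemma runs_step cf n q p T q' b m T' : runs n cf q p T -> ~~ halted q ->
  (if m is MLeft then 0 < p else true) -> delta q (T p) = (q', b, m) ->
  (forall i, (if i == p then b else T i) = T' i) ->
  runs n.+1 cf q' (moved m p) T'.
Proof.
move=> [l ln H] nh Hm D ET; exists l.+1 => //=.
have := rep_step H nh D Hm; case: (tm_step _) => [[q1 L] R] [-> Lq E].
by split=> // i; rewrite E ET.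
Qed.

Lemma tape_upd s (j : 'I_k) l i : setc (tape s i) j (onth l i) = tape (upd s j l) i.
Proof.
congr (_, _); apply/eq_from_tnth => j'; rewrite !tnth_mktuple.
by rewrite nth_set_nth /= -(inj_eq val_inj); case: ifP.
Qed.

Lemma tape_upd_eq s (j : 'I_k) l i :
  onth l i = onth (nth [::] s j) i -> tape (upd s j l) i = tape s i.
Proof.
move=> E; congr (_, _); apply/eq_from_tnth => j'; rewrite !tnth_mktuple.
by rewrite nth_set_nth /=; case: eqP => // ->.
Qed.

Lemma tnth_tape s i j : tnth (tape s i).2 j = onth (nth [::] s j) i.
Proof. by rewrite tnth_mktuple. Qed.

Lemma tops_tape s : size s = k -> tval (tape s 0).2 = tops s.
Proof.
move=> sk; apply: (@eq_from_nth _ None) => [|i]; rewrite ?size_tuple ?size_map // => ik.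
by rewrite -[i]/(val (Ordinal ik)) -tnth_nth tnth_tape (nth_map [::]) ?sk //=.
Qed.

Lemma runs_ret cf n q p T s : runs n cf (Some (q, Some sw_ret)) p T -> T =1 tape s ->
  runs (n + p.+1) cf (Some (q, None)) 0 (tape s).
Proof.
elim: p n T => [|p IH] n T H ET.
  rewrite addn1; apply: (runs_step (b := tape s 0) (m := MStay) H (halted_sweep _ _) isT) => [|i].
    by rewrite ET.
  by case: eqP => // ->.
rewrite addnS -addSn.
have H1 : runs n.+1 cf (Some (q, Some sw_ret)) p T.
  apply: (runs_step (b := tape s p.+1) (m := MLeft) H (halted_sweep _ _) isT) => [|i].
    by rewrite ET.
  by case: eqP => // ->.
exact: IH H1 ET.
Qed.

Lemma onth_default_le (l : seq G) i : size l <= i -> onth l i = None.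
Proof. by elim: l i => [|a l IH] [|i] //=; apply: IH. Qed.

Lemma onth_some (l : seq G) i : i < size l -> exists g, onth l i = Some g.
Proof. by elim: l i => [|a l IH] [|i] //= H; [exists a|apply: IH]. Qed.

(** The top of a stack sits in cell 0, so a push shifts the stack right by one. Cells before [p]
    already hold the new stack and [g] is the displaced element; the [d] remaining elements are
    crossed, then the head walks back to cell 0. *)
Lemma runs_push cf n q p T s (j : 'I_k) g0 g d :
  let s' := upd s j (g0 :: nth [::] s j) in
  size (nth [::] s j) = p + d -> onth (g0 :: nth [::] s j) p = Some g ->
  runs n cf (Some (q, Some (sw_push j g))) p T ->
  (forall i, T i = if i < p then tape s' i else tape s i) ->
  runs (n + 2 * d.+1 + p) cf (Some (q, None)) 0 (tape s').
Proof.
move=> s' Hs; elim: d n p T g Hs => [|d IH] n p T g Hs Hg H ET.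
  have -> : n + 2 * 1 + p = n.+1 + p.+1 by lia.
  have Tp : T p = tape s p by rewrite ET ltnn.
  apply: runs_ret (fun i => erefl).
  apply: (runs_step (m := MStay) H (halted_sweep _ _) isT) => [|i].
    by rewrite Tp /delta /delta_sweep /sw_push tnth_tape onth_default_le ?Hs ?addn0.
  rewrite -Hg tape_upd -/s'; case: eqP => [->//|ip].
  rewrite ET; case: ltnP => // pi; rewrite /s' tape_upd_eq //.
  by rewrite !onth_default_le //=; lia.
have Tp : T p = tape s p by rewrite ET ltnn.
have [g' Hg'] : exists g', onth (nth [::] s j) p = Some g' by apply: onth_some; lia.
have -> : n + 2 * d.+2 + p = n.+1 + 2 * d.+1 + p.+1 by lia.
apply: (IH n.+1 p.+1 (fun i => if i < p.+1 then tape s' i else tape s i) g'); rewrite ?Hs //;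
    first lia.
apply: (runs_step (m := MRight) H (halted_sweep _ _) isT) => [|i].
  by rewrite Tp /delta /delta_sweep /sw_push tnth_tape Hg'.
rewrite -Hg tape_upd -/s'; case: eqP => [->|ip]; first by rewrite ltnSn.
by rewrite ET !ltnS [i <= p]leq_eqVlt; move/eqP/negPf: ip => ->.
Qed.

Lemma onth_behead (l : seq G) i : onth (behead l) i = onth l i.+1.
Proof. by case: l i => [|a l] [|i]. Qed.

(** The shift to the left: the state carries the element of the right neighbour into cell [p], and
    the cells after [p] are already updated. *)
Lemma runs_pop cf n q p T s (j : 'I_k) :
  let s' := upd s j (behead (nth [::] s j)) in
  runs n cf (Some (q, Some (sw_pop j (onth (behead (nth [::] s j)) p)))) p T ->
  (forall i, T i = if i <= p then tape s i else tape s' i) ->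
  runs (n + p.+1) cf (Some (q, None)) 0 (tape s').
Proof.
move=> s'; elim: p n T => [|p IH] n T H ET.
  rewrite addn1; apply: (runs_step (m := MStay) H (halted_sweep _ _) isT) => [|i].
    by rewrite /delta /delta_sweep /sw_pop ET.
  by rewrite ET /= tape_upd -/s' leqn0; case: eqP => [->//|].
rewrite addnS -addSn.
apply: (IH n.+1 (fun i => if i <= p then tape s i else tape s' i)) => //.
apply: (runs_step (m := MLeft) H (halted_sweep _ _) isT) => [|i].
  by rewrite /delta /delta_sweep /sw_pop ET leqnn tnth_tape -(onth_behead (nth [::] s j) p).
rewrite tape_upd -/s'; case: eqP => [->|ip]; first by rewrite ltnn.
by rewrite ET [i <= p.+1]leq_eqVlt; move/eqP/negPf: ip => ->; rewrite ltnS.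
Qed.

Lemma runs_end cf n q p T s (j : 'I_k) d :
  let s' := upd s j (behead (nth [::] s j)) in
  size (nth [::] s j) = p + d ->
  runs n cf (Some (q, Some (sw_end j))) p T -> T =1 tape s ->
  runs (n + 2 * d.+1 + p) cf (Some (q, None)) 0 (tape s').
Proof.
move=> s' Hs; elim: d n p T Hs => [|d IH] n p T Hs H ET.
  have -> : n + 2 * 1 + p = n.+1 + p.+1 by lia.
  apply: (@runs_pop _ _ _ _ T) => [|i].
    apply: (runs_step (m := MStay) H (halted_sweep _ _) isT) => [|i]; last by case: eqP => // ->.
    rewrite ET /delta /delta_sweep /sw_end tnth_tape !onth_default_le ?size_behead ?Hs ?addn0 //.
    lia.
  rewrite ET; case: leqP => // pi; rewrite tape_upd_eq // !onth_default_le ?size_behead //; lia.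
have [g' Hg'] : exists g', onth (nth [::] s j) p = Some g' by apply: onth_some; lia.
have -> : n + 2 * d.+2 + p = n.+1 + 2 * d.+1 + p.+1 by lia.
apply: (IH n.+1 p.+1 T); rewrite ?Hs //; first lia.
apply: (runs_step (m := MRight) H (halted_sweep _ _) isT) => [|i]; last by case: eqP => // ->.
by rewrite ET /delta /delta_sweep /sw_end tnth_tape Hg'.
Qed.

Definition bounded M (s : store) := size s = k /\ forall j, size (nth [::] s j) <= M.

Lemma bounded_doact M s ac : bounded M s -> bounded M.+1 (doact ac s).
Proof.
move=> [sk B]; have U (j : 'I_k) l : size l <= M.+1 -> bounded M.+1 (upd s j l).
  move=> Hl; split=> [|j']; first by rewrite size_set_nth sk; apply/maxn_idPr; apply: ltn_ord.
  by rewrite nth_set_nth /=; case: ifP => // _; apply: leqW.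
case: ac => [j g|j|] /=; [by apply: U; rewrite /= ltnS|apply: U|].
  by rewrite size_behead (leq_trans (leq_pred _)) // leqW.
by split=> // j; apply: leqW.
Qed.

(** One control step, then a sweep out and back over a stack of height at most [M], which takes
    [2 * (M + 1)] steps. *)
Lemma runs_ctl cf n (q : points c) s M : bounded M s ->
  runs n cf (Some (inl q, None)) 0 (tape s) ->
  let r := cstep q (tops s) in
  runs (n + 2 * M + 3) cf (Some (r.1, None)) 0 (tape (doact r.2 s)).
Proof.
move=> [sk B] H r.
have H1 : runs n.+1 cf (Some (r.1, sweep_of r.2)) 0 (tape s).
  apply: (runs_step (m := MStay) H (halted_ctl _ _) isT) => [|i]; last by case: eqP => // ->.
  by rewrite /delta /delta_ctl tops_tape.
have W n1 n2 q1 T1 : n1 <= n2 -> runs n1 cf q1 0 T1 -> runs n2 cf q1 0 T1.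
  by move=> H2 [m Hm R]; exists m => //; apply: leq_trans H2.
case: r.2 H1 => [j g|j|] /= H1.
- apply: W (@runs_push _ _ _ _ _ s j g g (size (nth [::] s j)) _ _ H1 _) => //.
  by have := B j; lia.
- apply: W (@runs_end _ _ _ _ _ s j (size (nth [::] s j)) _ H1 _) => //.
  by have := B j; lia.
- by apply: W H1; lia.
Qed.

(** A program step raises a stack by at most one, so no height exceeds [M + t] and every sweep has
    the same bound. *)
Lemma runs_reach cf q s r s' t M n : reach q s r s' t -> bounded M s ->
  runs n cf (Some (q, None)) 0 (tape s) ->
  runs (n + t * (2 * (M + t) + 3)) cf (Some (r, None)) 0 (tape s').
Proof.
move=> R; elim: R M n => [r1 s1|q1 s1 r1 ac r2 s2 t1 E _ IH] M n B H.
  by rewrite mul0n addn0.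
have := runs_ctl B H; rewrite E /= => /(IH _ _ (bounded_doact ac B)) [m Hm Rm].
exists m => //; apply: leq_trans Hm _; lia.
Qed.

Lemma runs_init x : let cf := tm_init machine x in
  runs 1 cf (Some (inl (start c), None)) 0 (tape (map inj x :: nseq k' [::])).
Proof.
move=> cf; pose T i := nth (tm_blank machine) (map (tm_input machine) x) i.
have H : runs 0 cf None 0 T by exists 0.
apply: (runs_step (m := MStay) H isT isT) => [|i]; first by [].
have E : (T i).2 = (tape (map inj x :: nseq k' [::]) i).2.
  apply/eq_from_tnth => j; rewrite tnth_tape /T.
  have [xi|xi] := ltnP i (size x); last first.
    rewrite nth_default ?size_map //= tnth_mktuple -[LHS]/None.
    case: (val j) => [|j'] /=; first by rewrite onth_default_le ?size_map.
    by rewrite nth_nseq if_same onth_default_le.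
  case: x xi @cf T H => // a x xi _ _ _; rewrite (nth_map a) //= tnth_mktuple -(inj_eq val_inj) /=.
  case: (val j) => [|j'] /=; last by rewrite nth_nseq if_same onth_default_le.
  elim: x a i xi => [|b x IH] a [|i] //= ix; rewrite -(IH b) // (set_nth_default b) //.
case: i E => [|i] /= E; first by rewrite /= E.
rewrite /tape -E /T; case: (ltnP i.+1 (size x)) => xi.
  by case: x xi {cf T H E} => // a x xi; rewrite (nth_map a).
by rewrite nth_default ?size_map.
Qed.

Lemma iter_halted cf q p T n : rep cf q p T -> halted q ->
  iter n (@tm_step _ machine) cf = cf.
Proof.
case: cf => [[q0 L] R] [-> _ _] Hq; elim: n => //= n ->.
by rewrite /tm_step; rewrite /halted in Hq; rewrite /= Hq.
Qed.

Lemma bounded_init x : bounded (size x) (map inj x :: nseq k' [::]).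
Proof.
split=> [|[|j]] /=; rewrite ?size_nseq ?size_map //.
by rewrite nth_nseq if_same.
Qed.

Lemma runs_exec x o T : exec c (map inj x :: nseq k' [::]) o T ->
  exists s, runs (1 + T * (2 * (size x + T) + 3)) (tm_init machine x)
    (Some (inr (isSome o), None)) 0 (tape s).
Proof.
move=> [t [s' [tT R _]]]; exists s'.
have [m Hm Rm] := runs_reach R (bounded_init x) (runs_init x).
by exists m => //; apply: leq_trans Hm _; rewrite leq_add2l leq_mul //; lia.
Qed.

Lemma machine_accepts x s T n : exec c (map inj x :: nseq k' [::]) (Some s) T ->
  1 + T * (2 * (size x + T) + 3) <= n -> accepts_within machine x n.
Proof.
move=> /runs_exec[s' [m Hm R]] Hn; rewrite /accepts_within.
have mn : m <= n by apply: leq_trans Hn.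
rewrite -(subnK mn) iterD (iter_halted _ R) //.
by case: (iter _ _ _) R => [[q L] Rt] [-> _ _] /=.
Qed.

(** Halting configurations are absorbing and iterates commute: [m] further steps after [n], and [n]
    further steps after [m], give the same configuration, which cannot be both accepting and
    rejecting. *)
Lemma machine_rejects x T n : exec c (map inj x :: nseq k' [::]) None T ->
  ~~ accepts_within machine x n.
Proof.
move=> /runs_exec[s' [m Hm R]]; rewrite /accepts_within.
have Rn : iter m (@tm_step _ machine) (iter n (@tm_step _ machine) (tm_init machine x)) =
          iter n (@tm_step _ machine) (iter m (@tm_step _ machine) (tm_init machine x)).
  by rewrite -!iterD addnC.
rewrite (iter_halted n R) // in Rn.
case E : (iter n _ _) Rn => [[q L] Rt] Rn; apply/negP => Hq.
have Rq : rep (q, L, Rt) q (size L) (nth (tm_blank machine) (catrev L Rt)) by [].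
rewrite (iter_halted m Rq) in Rn; last by rewrite /halted (eqP Hq) eqxx.
by rewrite -Rn in R; case: R => Eq _ _; move: Hq; rewrite Eq.
Qed.
End Compile.
End StackMachine.

(** * The verifier *)

Section Verifier.
Variable S : finType.
Implicit Types (c d : S) (w v p q : seq S) (us vs ws : seq (seq S)) (r : option S) (bs : seq bool).

(* The right summand holds marked letters, which match first positions only. *)
Definition gam : finType := (tok S + option bool + S)%type.
Notation com := (com gam 5).
Notation act := (act gam 5).
Notation stack := (seq gam).
Notation "# i" := (@Ordinal 6 i isT) (at level 2, i at level 1, format "# i").
Implicit Types (o wd kb pt tt xt : stack) (g : gam) (s : seq stack).

Definition letter c : gam := inl (inl (inl c)).
Definition mark c : gam := inr c.
Definition eow : gam := inl (inl (t_eow S)).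
Definition eol : gam := inl (inl (t_eol S)).
Definition bit b : gam := inl (inl (t_bit S b)).
Definition sep : gam := inl (inr None).
Definition orac b : gam := inl (inr (Some b)).

Definition is_letter g := if g is inl (inl (inl _)) then true else false.

Lemma letter_inj : injective letter. Proof. by move=> c d []. Qed.

Lemma inord4 i j : i < 4 -> j < 4 -> (@inord 3 i == @inord 3 j) = (i == j).
Proof. by move=> Hi Hj; rewrite -val_eqE /= !inordK. Qed.

Lemma eow_eol : (eow == eol) = false. Proof. exact: inord4. Qed.
Lemma bit_eq b b' : (bit b == bit b') = (b == b').
Proof. by case: b b' => [] []; exact: inord4. Qed.
Lemma eol_bit b : (eol == bit b) = false. Proof. by case: b; exact: inord4. Qed.

(* Stacks: certificate, words, budget, current path, and two work stacks. *)
Definition St o wd kb pt tt xt : seq stack := [:: o; wd; kb; pt; tt; xt].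

Notation top i tp := (nth None tp i).

Definition skip : com := Act (fun _ => ANop _ _).
Definition push (j : 'I_6) g : com := Act (fun _ => APush j g).
Definition pop (j : 'I_6) : com := Act (fun _ => APop _ j).
Definition mov (i j : 'I_6) : com :=
  Seq (Act (fun tp => if top i tp is Some g then APush j g else ANop _ _)) (pop i).
Definition movwhile (P : pred gam) (i j : 'I_6) : com :=
  While (fun tp => oapp P false (top i tp)) (mov i j).

Lemma exec_eq (cm : com) s (o1 o2 : option (seq stack)) t : exec cm s o1 t -> o1 = o2 -> exec cm s
    o2 t.
Proof. by move=> H <-. Qed.

Lemma size_upd (i : 'I_6) s l : size s = 6 -> size (upd s i l) = 6.
Proof. by move=> sz; rewrite size_set_nth sz; apply/maxn_idPr; apply: ltn_ord. Qed.

Lemma exec_mov (i j : 'I_6) s g l : i != j -> size s = 6 -> nth [::] s i = g :: l ->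
  exec (mov i j) s (Some (upd (upd s j (g :: nth [::] s j)) i l)) 2.
Proof.
move=> ij sz E.
have H1 := exec_act (fun tp => if top i tp is Some g then APush j g else ANop _ _) s.
rewrite (nth_map [::]) ?sz // E /= in H1.
apply: exec_eq (exec_seq H1 (exec_act (fun _ => APop _ i) _)) _.
by rewrite /= nth_set_nth /= -(inj_eq val_inj) in ij *; rewrite (negPf ij) E.
Qed.

Lemma exec_movwhile (P : pred gam) (i j : 'I_6) s l rs : i != j -> size s = 6 ->
  nth [::] s i = l ++ rs -> all P l -> ~~ oapp P false (ohead rs) ->
  exec (movwhile P i j) s (Some (upd (upd s j (catrev l (nth [::] s j))) i rs)) (3 * size l + 1).
Proof.
move=> ij; have nij : (i == j :> nat) = false := negbTE ij.
elim: l s => [|g l IH] s sz E.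
  move=> _ Hr; apply: exec_eq (exec_while_end _ _) _.
    by rewrite (nth_map [::]) ?sz ?E.
  congr Some; apply: (@eq_from_nth _ [::]) => [|n _]; first by rewrite !size_upd.
  rewrite nth_set_nth /=; case: eqP => [->|_]; first by rewrite E.
  by rewrite nth_set_nth /=; case: eqP => [->|].
move=> /= /andP[Pg Pl] Hr.
have H1 := exec_mov ij sz E.
set s1 := upd _ _ _ in H1.
have Ei : nth [::] s1 i = l ++ rs by rewrite nth_set_nth /= eqxx.
have Ej : nth [::] s1 j = g :: nth [::] s j.
  by rewrite !nth_set_nth /= eq_sym nij !nth_set_nth /= eqxx.
have s1z : size s1 = 6 by rewrite !size_upd.
have := IH s1 s1z Ei Pl Hr; rewrite Ej => H2.
apply: exec_le (exec_eq (exec_while _ H1 H2) _) _; [|congr Some|by move: (size l) => n; lia].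
  by rewrite (nth_map [::]) ?sz // E /= Pg.
apply: (@eq_from_nth _ [::]) => [|n _]; first by rewrite !size_upd.
rewrite !nth_set_nth /=; case: eqP => // ni; rewrite !nth_set_nth /=; case: eqP => // nj.
by rewrite !nth_set_nth /=; case: eqP => // _; rewrite nth_set_nth /=; case: eqP.
Qed.

(** * Testing the current path on the words *)

Definition enc_path r p : stack := (if r is Some c then [:: mark c] else [::]) ++ map letter p.

Definition body ws : stack := flatten [seq rcons (map letter w) eow | w <- ws].

Definition encw ws : stack := rcons (body ws) eol.

Definition top_is g (i : 'I_6) : pred (seq (option gam)) := fun tp => top i tp == Some g.

(** The greedy scan of [pmatch_greedy]: the word letter stays in place while pattern letters are
    moved, so one position can serve several of them. *)
Definition eat : com :=
  While (fun tp => if top 4 tp is Some (inl (inl (inl c)))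
                   then top 1 tp == Some (letter c) else false) (mov #4 #3).

Definition scan : com :=
  While (fun tp => oapp is_letter false (top 1 tp)) (Seq eat (mov #1 #5)).

Definition match_word : com :=
  Seq (If (fun tp => if (top 4 tp, top 1 tp) is (Some (inr c), Some (inl (inl (inl d))))
                     then c == d else false) (mov #4 #3) skip) scan.

Lemma exec_skip s : exec skip s (Some s) 1.
Proof. exact: (exec_act _ s). Qed.

Lemma exec_eat o a wd kb pt q xt : exists q1 q2,
  [/\ q = q1 ++ q2, pmatch q2 =1 (fun w => pmatch q (a :: w)) &
  exec eat (St o (letter a :: wd) kb pt (map letter q) xt)
    (Some (St o (letter a :: wd) kb (catrev (map letter q1) pt) (map letter q2) xt))
    (3 * size q1 + 1)].
Proof.
elim: q pt => [|c q IH] pt; first by exists [::], [::]; split=> //; apply: exec_while_end.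
have [/eqP E|ne] := boolP (a == c); last first.
  exists [::], (c :: q); split=> // [w|]; first by rewrite pmatch_greedy (negPf ne).
  by apply: exec_while_end; rewrite /= (inj_eq Some_inj) (inj_eq letter_inj).
subst c; have [q1 [q2 [Eq M H]]] := IH (letter a :: pt).
exists (a :: q1), q2; split=> [|w|]; first by rewrite Eq.
  by rewrite pmatch_greedy eqxx M.
apply: exec_le (exec_while (s1 := St o (letter a :: wd) kb (letter a :: pt) (map letter q) xt) _ _
    H) _.
- by rewrite /= eqxx.
- exact: exec_mov.
- by rewrite /= mulnS; lia.
Qed.

Lemma exec_mov15 o g wd kb pt tt xt :
  exec (mov #1 #5) (St o (g :: wd) kb pt tt xt) (Some (St o wd kb pt tt (g :: xt))) 2.
Proof. exact: exec_mov. Qed.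

Lemma exec_scan o w wd kb pt q xt : ~~ oapp is_letter false (ohead wd) -> exists q1 q2,
  [/\ q = q1 ++ q2, (q2 == [::]) = pmatch q w &
  exec scan (St o (map letter w ++ wd) kb pt (map letter q) xt)
    (Some (St o wd kb (catrev (map letter q1) pt) (map letter q2) (catrev (map letter w) xt)))
    (3 * size q1 + 4 * size w + 1)].
Proof.
move=> Hwd; elim: w q pt xt => [|a w IH] q pt xt.
  by exists [::], q; split=> //; [case: q|apply: exec_while_end].
have [q1 [q2 [Eq M H]]] := exec_eat o a (map letter w ++ wd) kb pt q xt.
have [q3 [q4 [Eq' M' H']]] := IH q2 (catrev (map letter q1) pt) (letter a :: xt).
exists (q1 ++ q3), q4; split; first by rewrite Eq Eq' catA.
  by rewrite M' M.
have -> : catrev (map letter (q1 ++ q3)) pt = catrev (map letter q3) (catrev (map letter q1) pt).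
  by rewrite map_cat catrev_catl.
apply: exec_le (exec_while _ (exec_seq H (exec_mov15 _ _ _ _ _ _ _)) H') _ => //.
by rewrite size_cat /=; move: (size q1) (size q3) (size w) => *; lia.
Qed.

(* A mark that does not match the first letter stays on top and blocks the match. *)
Lemma exec_scan_blocked o w wd kb pt c tt xt : ~~ oapp is_letter false (ohead wd) ->
  exec scan (St o (map letter w ++ wd) kb pt (mark c :: tt) xt)
    (Some (St o wd kb pt (mark c :: tt) (catrev (map letter w) xt))) (4 * size w + 1).
Proof.
move=> Hwd; elim: w xt => [|a w IH] xt; first exact: exec_while_end.
have H : exec eat (St o (map letter (a :: w) ++ wd) kb pt (mark c :: tt) xt)
  (Some (St o (map letter (a :: w) ++ wd) kb pt (mark c :: tt) xt)) 1 by exact: exec_while_end.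
apply: exec_le (exec_while _ (exec_seq H (exec_mov15 _ _ _ _ _ _ _)) (IH _)) _ => //.
by rewrite /=; move: (size w) => *; lia.
Qed.

Lemma exec_match_word o w wd kb r q xt : ~~ oapp is_letter false (ohead wd) -> exists z1 z2,
  [/\ enc_path r q = z1 ++ z2, (z2 == [::]) = root_ok r w && pmatch q w &
  exec match_word (St o (map letter w ++ wd) kb [::] (enc_path r q) xt)
    (Some (St o wd kb (rev z1) z2 (catrev (map letter w) xt)))
    (3 * size z1 + 4 * size w + 3)].
Proof.
move=> Hwd; case: r => [c|].
  have [/eqP Hc|Hc] := boolP (ohead w == Some c).
    case: w Hc => // a w [->].
    have [q1 [q2 [Eq M H]]] := exec_scan o (c :: w) kb [:: mark c] q xt Hwd.
    exists (mark c :: map letter q1), (map letter q2); split.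
    - by rewrite /enc_path /= Eq map_cat.
    - by rewrite /= eqxx -M; case: q2 {Eq M H}.
    have H1 : exec (mov #4 #3) (St o (map letter (c :: w) ++ wd) kb [::] (enc_path (Some c) q) xt)
      (Some (St o (map letter (c :: w) ++ wd) kb [:: mark c] (map letter q) xt)) 2.
      exact: exec_mov.
    rewrite rev_cons -cats1 -catrevE.
    apply: exec_le (exec_seq (exec_if (t := 2) _) H) _; first by rewrite /= eqxx.
    by rewrite /= size_map; lia.
  exists [::], (enc_path (Some c) q); split=> //; first by rewrite /= (negPf Hc).
  have H := exec_scan_blocked o w kb [::] c (map letter q) xt Hwd.
  apply: exec_le (exec_seq (exec_if (t := 1) _) H) _.
    rewrite /=; case: w Hc {H} => [|a w] /=; last first.
      rewrite (inj_eq Some_inj) eq_sym => /negPf->; exact: exec_skip.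
    by move=> _; case: wd Hwd => [|[[[d|x]|x]|x] wd] //= _; exact: exec_skip.
  by rewrite /=; lia.
have [q1 [q2 [Eq M H]]] := exec_scan o w kb [::] q xt Hwd.
exists (map letter q1), (map letter q2); split.
- by rewrite /enc_path /= Eq map_cat.
- by rewrite /= -M; case: q2 {Eq M H}.
apply: exec_le (exec_seq (exec_if (t := 1) _) H) _; last by rewrite /= size_map; lia.
by rewrite /=; case: (q) => [|d q'] /=; exact: exec_skip.
Qed.

(** [bad] handles a word that does not match: abort for a positive word, [discard] for a negative
    one. *)
Definition word (bad : com) : com :=
  Seq match_word (Seq (If (fun tp => top 4 tp == None) (mov #1 #5) bad) (movwhile predT #3 #4)).

Definition words (bad : com) : com :=
  While (fun tp => oapp (predC1 eol) false (top 1 tp)) (word bad).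

(** The letters just read lie on stack 5 above a separator or the bottom, so popping letters removes
    exactly this word. *)
Definition discard : com :=
  Seq (pop #1) (While (fun tp => oapp is_letter false (top 5 tp)) (pop #5)).

Lemma exec_restore o wd kb z1 z2 xt :
  exec (movwhile predT #3 #4) (St o wd kb (rev z1) z2 xt)
    (Some (St o wd kb [::] (z1 ++ z2) xt)) (3 * size z1 + 1).
Proof.
have := @exec_movwhile predT #3 #4 (St o wd kb (rev z1) z2 xt) (rev z1) [::].
rewrite size_rev catrevE revK; apply=> //; first by rewrite cats0.
exact: all_predT.
Qed.

Definition wcost r q w := 6 * size w + 6 * size (enc_path r q) + 15.

Lemma exec_word o w wd kb r q xt bad wd' xt' :
  (root_ok r w && pmatch q w -> wd' = wd /\ xt' = eow :: catrev (map letter w) xt) ->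
  (~~ (root_ok r w && pmatch q w) -> forall z1 z2,
     exec bad (St o (eow :: wd) kb z1 z2 (catrev (map letter w) xt))
      (Some (St o wd' kb z1 z2 xt')) (2 * size w + 2)) ->
  exec (word bad) (St o (map letter w ++ eow :: wd) kb [::] (enc_path r q) xt)
    (Some (St o wd' kb [::] (enc_path r q) xt')) (wcost r q w).
Proof.
move=> Hok Hbad.
have [z1 [z2 [E M H]]] := @exec_match_word o w (eow :: wd) kb r q xt isT.
have R := exec_restore o wd' kb z1 z2 xt'; rewrite -E in R.
apply: exec_le (exec_seq H (exec_seq (s1 := St o wd' kb (rev z1) z2 xt') (exec_if (t := 2 * size w
    + 2) _) R)) _.
  have -> : (top 4 (tops (St o (eow :: wd) kb (rev z1) z2 (catrev [seq letter i | i <- w] xt))) ==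
      None) = (z2 == [::]).
    by rewrite /=; case: (z2).
  rewrite M; case: ifP => [/Hok[-> ->]|/negbT/Hbad//].
  by apply: exec_le (exec_mov15 _ _ _ _ _ _ _) _; lia.
rewrite /wcost E size_cat; move: (size z1) (size z2) (size w) => *; lia.
Qed.

Lemma exec_word_abort o w wd kb r q xt : ~~ (root_ok r w && pmatch q w) ->
  exists t, exec (word (Abort _ _)) (St o (map letter w ++ eow :: wd) kb [::] (enc_path r q) xt)
      None t.
Proof.
move=> Hbad.
have [z1 [z2 [E M H]]] := @exec_match_word o w (eow :: wd) kb r q xt isT.
eexists; apply: exec_seq H (exec_seq_abort _ (exec_if (t := 1) _)).
have -> : (top 4 (tops (St o (eow :: wd) kb (rev z1) z2 (catrev [seq letter i | i <- w] xt))) ==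
    None) = (z2 == [::]).
  by rewrite /=; case: (z2).
by rewrite M (negPf Hbad); exact: exec_abort.
Qed.

Lemma exec_discard o w wd kb z1 z2 xt : ~~ oapp is_letter false (ohead xt) ->
  exec discard (St o (eow :: wd) kb z1 z2 (catrev (map letter w) xt))
      (Some (St o wd kb z1 z2 xt)) (2 * size w + 2).
Proof.
move=> Hx; rewrite catrevE -map_rev -(size_rev w); move: (rev w) => {}w.
have H1 := exec_act (fun _ => APop _ #1) (St o (eow :: wd) kb z1 z2 (map letter w ++ xt)).
have H2 : exec (While (fun tp => oapp is_letter false (top 5 tp)) (pop #5))
    (St o wd kb z1 z2 (map letter w ++ xt)) (Some (St o wd kb z1 z2 xt)) (2 * size w + 1).
  elim: w {H1} => [|a w IH]; first exact: exec_while_end.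
  have H1 := exec_act (fun _ => APop _ #5) (St o wd kb z1 z2 (map letter (a :: w) ++ xt)).
  by apply: exec_le (exec_while _ H1 IH) _ => //=; move: (size w) => *; lia.
by apply: exec_le (exec_seq H1 H2) _; move: (size w) => *; lia.
Qed.

Lemma body_cons w ws : body (w :: ws) = map letter w ++ eow :: body ws.
Proof. by rewrite /body /= cat_rcons. Qed.

Definition fits r q := fun w => root_ok r w && pmatch q w.

Definition wscost r q ws := (6 * size (enc_path r q) + 16) * size (body ws) + 1.

Lemma wscost_cons r q w ws : (wcost r q w + wscost r q ws).+1 <= wscost r q (w :: ws).
Proof.
rewrite /wcost /wscost body_cons size_cat /= size_map.
move: (size w) (size (body ws)) (size (enc_path _ _)) => *; nia.
Qed.

Lemma body_top w ws wd : oapp (predC1 eol) false (ohead (body (w :: ws) ++ wd)).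
Proof. by rewrite body_cons; case: w => [|a w] //=; rewrite eow_eol. Qed.

Lemma exec_words_check o ws wd kb r q xt :
  if all (fits r q) ws then
    exec (words (Abort _ _)) (St o (body ws ++ eol :: wd) kb [::] (enc_path r q) xt)
      (Some (St o (eol :: wd) kb [::] (enc_path r q) (catrev (body ws) xt))) (wscost r q ws)
  else exists t,
    exec (words (Abort _ _)) (St o (body ws ++ eol :: wd) kb [::] (enc_path r q) xt) None t.
Proof.
elim: ws xt => [|w ws IH] xt.
  by apply: exec_le (exec_while_end _ _) _; rewrite /= ?eqxx // /wscost addn1.
have Hc := body_top w ws (eol :: wd).
rewrite /=; case Hw: (fits r q w) => /=; last first.
  rewrite body_cons -catA; have [t H] := exec_word_abort o (body ws ++ eol :: wd) kb xt (negbT Hw).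
  by eexists; apply: exec_while_abort H; move: Hc; rewrite body_cons -catA.
have H1 : exec (word (Abort _ _)) (St o (body (w :: ws) ++ eol :: wd) kb [::] (enc_path r q) xt)
  (Some (St o (body ws ++ eol :: wd) kb [::] (enc_path r q) (eow :: catrev (map letter w) xt)))
      (wcost r q w).
  by rewrite body_cons -catA; apply: exec_word => //; rewrite -/(fits r q w) Hw.
have E : catrev (body (w :: ws)) xt = catrev (body ws) (eow :: catrev (map letter w) xt).
  by rewrite body_cons catrev_catl.
have := IH (eow :: catrev (map letter w) xt); rewrite -E; case: ifP => _.
  by move=> H2; apply: exec_le (wscost_cons _ _ _ _); apply: exec_while H1 H2.
by move=> [t H2]; eexists; apply: exec_while H1 H2.
Qed.

Lemma exec_words_filter o ws wd kb r q xt : ~~ oapp is_letter false (ohead xt) ->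
  exec (words discard) (St o (body ws ++ eol :: wd) kb [::] (enc_path r q) xt)
    (Some (St o (eol :: wd) kb [::] (enc_path r q) (catrev (body (filter (fits r q) ws)) xt)))
    (wscost r q ws).
Proof.
elim: ws xt => [|w ws IH] xt Hx.
  by apply: exec_le (exec_while_end _ _) _; rewrite /= ?eqxx // /wscost addn1.
have Hc := body_top w ws (eol :: wd).
pose xt' := if fits r q w then eow :: catrev (map letter w) xt else xt.
have Hx' : ~~ oapp is_letter false (ohead xt') by rewrite /xt'; case: ifP.
have H1 : exec (word discard) (St o (body (w :: ws) ++ eol :: wd) kb [::] (enc_path r q) xt)
  (Some (St o (body ws ++ eol :: wd) kb [::] (enc_path r q) xt')) (wcost r q w).
  rewrite body_cons -catA; apply: exec_word => // Hw; rewrite /xt' -/(fits r q w) in Hw *.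
    by rewrite Hw.
  by move=> z1 z2; rewrite (negPf Hw); apply: exec_discard.
have E : catrev (body (filter (fits r q) (w :: ws))) xt = catrev (body (filter (fits r q) ws)) xt'.
  by rewrite /xt' /=; case: ifP => // _; rewrite body_cons catrev_catl.
rewrite E; apply: exec_le (wscost_cons _ _ _ _).
exact: exec_while H1 (IH _ Hx').
Qed.
(** Both lists are transferred in reverse to stack 5; a single move brings them back in order. The
    path goes to stack 4 and back in the same way. *)
Definition check : com :=
  Seq (movwhile predT #3 #4) (Seq (words (Abort _ _)) (Seq (mov #1 #5) (Seq (words discard)
    (Seq (mov #1 #5) (Seq (movwhile predT #5 #1) (movwhile predT #4 #3)))))).

Lemma size_body_filter (P : pred (seq S)) ws : size (body (filter P ws)) <= size (body ws).
Proof.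
elim: ws => //= w ws IH; case: ifP => _; rewrite !body_cons !size_cat /=.
  by move: IH; move: (size _) (size (body ws)) (size _) => *; lia.
by move: IH; move: (size _) (size (body ws)) (size _) => *; lia.
Qed.

Lemma encw_cat us vs : encw us ++ encw vs = body us ++ eol :: body vs ++ [:: eol].
Proof. by rewrite /encw cat_rcons -cats1. Qed.

Definition ccost e n := 30 * (e + 1) * (n + 1).

Lemma exec_check o us vs kb r q :
  if all (fits r q) us then
    exec check (St o (encw us ++ encw vs) kb (rev (enc_path r q)) [::] [::])
      (Some (St o (encw us ++ encw (filter (fits r q) vs)) kb (rev (enc_path r q)) [::] [::]))
      (ccost (size (enc_path r q)) (size (encw us ++ encw vs)))
  else exists t,
    exec check (St o (encw us ++ encw vs) kb (rev (enc_path r q)) [::] [::]) None t.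
Proof.
set vs' := filter _ vs; set e := enc_path r q.
have H1 := exec_restore o (encw us ++ encw vs) kb e [::] [::]; rewrite cats0 encw_cat in H1.
have := exec_words_check o us (body vs ++ [:: eol]) kb r q [::]; case: ifP => _; last first.
  move=> [t H2]; eexists; rewrite encw_cat.
  exact: exec_seq H1 (exec_seq_abort _ H2).
move=> H2; rewrite -/e in H2.
have H3 := exec_mov15 o eol (body vs ++ [:: eol]) kb [::] e (catrev (body us) [::]).
have H4 := @exec_words_filter o vs [::] kb r q (eol :: catrev (body us) [::]) isT.
rewrite -/e -/vs' in H4.
have H5 := exec_mov15 o eol [::] kb [::] e (catrev (body vs') (eol :: catrev (body us) [::])).
set X := eol :: catrev (body vs') _ in H5.
have EX : catrev X [::] = encw us ++ encw vs'.
  rewrite catrevE cats0 /X !catrevE cats0 rev_cons rev_cat rev_cons !revK cat_rcons.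
  by rewrite encw_cat rcons_cat /= -cats1.
have H6 : exec (movwhile predT #5 #1) (St o [::] kb [::] e X)
    (Some (St o (encw us ++ encw vs') kb [::] e [::])) (3 * size X + 1).
  rewrite -EX; apply: (@exec_movwhile predT #5 #1 (St o [::] kb [::] e X) X [::]) => //.
    by rewrite /= cats0.
  exact: all_predT.
have H7 : exec (movwhile predT #4 #3) (St o (encw us ++ encw vs') kb [::] e [::])
    (Some (St o (encw us ++ encw vs') kb (rev e) [::] [::])) (3 * size e + 1).
  apply: exec_eq (@exec_movwhile predT #4 #3 (St o (encw us ++ encw vs') kb [::] e [::]) e [::] _
      _ _ _ _) _ => //.
  - by rewrite /= cats0.
  - exact: all_predT.
rewrite encw_cat; apply: exec_le (exec_seq H1 (exec_seq H2 (exec_seq H3 (exec_seq H4 (exec_seq H5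
    (exec_seq H6 H7)))))) _.
have : size X <= size (body us) + size (body vs) + 2.
  have := size_body_filter (fits r q) vs; rewrite -/vs' => L.
  rewrite -[size X]size_rev -[rev X]/(catrev X [::]) EX encw_cat !size_cat /= size_cat /=.
  by move: L; move: (size (body us)) (size (body vs)) (size (body vs')) => *; lia.
rewrite /wscost /ccost !size_cat /= size_cat /= -/e.
move: (size X) (size e) (size (body us)) (size (body vs)) => x e' a b *; nia.
Qed.

(** * The budget as a binary counter *)

Fixpoint bval bs := if bs is b :: bs' then b + 2 * bval bs' else 0.

(** Borrowing from the least significant bit: low zeros become ones until the lowest one, which
    becomes zero. The number of bits is kept, leading zeros included, so the cost of later
    decrements does not change. *)
Definition dec : com :=
  Seq (While (top_is (bit false) #2) (Seq (push #5 (bit true)) (pop #2)))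
      (Seq (If (top_is (bit true) #2) (Seq (pop #2) (push #2 (bit false))) (Abort _ _))
           (movwhile predT #5 #2)).

Lemma exec_dec o wd bs pt :
  if 0 < bval bs then exists bs', [/\ size bs' = size bs, bval bs' = (bval bs).-1 &
    exec dec (St o wd (map bit bs) pt [::] [::]) (Some (St o wd (map bit bs') pt [::] [::]))
      (8 * size bs + 8)]
  else exists t, exec dec (St o wd (map bit bs) pt [::] [::]) None t.
Proof.
have [a [l [E Hl]]] : exists a l, bs = nseq a false ++ l /\ (l = [::] \/ exists l', l = true :: l').
  elim: bs => [|[] bs [a [l [E Hl]]]]; first by exists 0, [::]; split=> //; left.
    by exists 0, (true :: bs); split=> //; right; exists bs.
  by exists a.+1, l; rewrite E.
have H1 xt : exec (While (top_is (bit false) #2) (Seq (push #5 (bit true)) (pop #2)))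
   (St o wd (map bit bs) pt [::] xt) (Some (St o wd (map bit l) pt [::] (nseq a (bit true) ++ xt)))
   (3 * a + 1).
  rewrite E {E}; elim: a xt => [|a IH] xt.
    apply: exec_while_end; case: Hl => [->//|[l' ->]].
    by rewrite /top_is /= (inj_eq Some_inj) bit_eq.
  have Ha : exec (Seq (push #5 (bit true)) (pop #2))
     (St o wd (map bit (nseq a.+1 false ++ l)) pt [::] xt)
     (Some (St o wd (map bit (nseq a false ++ l)) pt [::] (bit true :: xt))) 2.
    exact: (exec_seq (exec_act (fun _ => APush #5 (bit true)) _) (exec_act (fun _ => APop _ #2) _)).
  have Hn : nseq a.+1 (bit true) ++ xt = nseq a (bit true) ++ bit true :: xt.
    by rewrite /=; elim: (a) => //= n <-.
  rewrite Hn; apply: exec_le (exec_while _ Ha (IH _)) _; last by lia.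
  by rewrite /top_is /= eqxx.
have {}H1 := H1 [::]; rewrite cats0 in H1.
case: Hl => [El|[l' El]]; subst l.
  have -> : bval bs = 0 by rewrite E cats0; elim: (a) => //= n ->.
  eexists; apply: exec_seq H1 (exec_seq_abort _ (exec_if (t := 1) _)).
  exact: exec_abort.
have [E1 E2] : bval bs = (bval (nseq a true ++ false :: l')).+1 /\
    size (nseq a true ++ false :: l') = size bs.
  by rewrite E; elim: (a) => //= n [H ->]; split=> //; lia.
rewrite E1; exists (nseq a true ++ false :: l'); split=> //.
have H2 : exec (Seq (pop #2) (push #2 (bit false)))
   (St o wd (map bit (true :: l')) pt [::] (nseq a (bit true)))
   (Some (St o wd (map bit (false :: l')) pt [::] (nseq a (bit true)))) 2.
  exact: (exec_seq (exec_act (fun _ => APop _ #2) _) (exec_act (fun _ => APush #2 (bit false)) _)).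
have H3 : exec (movwhile predT #5 #2) (St o wd (map bit (false :: l')) pt [::] (nseq a (bit true)))
   (Some (St o wd (map bit (nseq a true ++ false :: l')) pt [::] [::])) (3 * a + 1).
  have En : map bit (nseq a true ++ false :: l') = catrev (nseq a (bit true)) (map bit (false ::
      l')).
    by rewrite map_cat map_nseq catrevE rev_nseq.
  rewrite En -[in 3 * a](size_nseq a (bit true)).
  apply: (@exec_movwhile predT #5 #2 _ _ [::]) => //; first by rewrite /= cats0.
  exact: all_predT.
apply: exec_le (exec_seq H1 (exec_seq (exec_if (t := 2) _) H3)) _.
  by rewrite /top_is /= eqxx.
rewrite -E2 size_cat size_nseq /=; lia.
Qed.

Fixpoint decs n (c : com) : com := if n is n'.+1 then Seq dec (decs n' c) else c.

Lemma exec_decs n (c : com) o wd bs pt :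
  if n <= bval bs then exists bs', [/\ size bs' = size bs, bval bs' = bval bs - n &
    forall out t, exec c (St o wd (map bit bs') pt [::] [::]) out t ->
    exec (decs n c) (St o wd (map bit bs) pt [::] [::]) out (n * (8 * size bs + 8) + t)]
  else exists t, exec (decs n c) (St o wd (map bit bs) pt [::] [::]) None t.
Proof.
elim: n bs => [|n IH] bs; first by exists bs; rewrite subn0.
have := exec_dec o wd bs pt; case: ifP => [b0 [bs1 [S1 V1 H1]]|b0 [t H]]; last first.
  rewrite leqNgt ltnS (_ : bval bs <= n); last by move: b0; case: (bval bs).
  by exists t; apply: exec_seq_abort.
have := IH bs1; rewrite V1 -ltnS prednK //; case: ifP => _; last first.
  by move=> [t H]; eexists; apply: exec_seq H1 H.
move=> [bs2 [S2 V2 H2]]; exists bs2; split; [by rewrite S2|by rewrite V2; lia|].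
move=> out t /H2 H3; apply: exec_le (exec_seq H1 H3) _.
by rewrite S1 mulSn addnA.
Qed.

Definition enter g n : com := Seq (push #3 g) (decs n check).

Definition cfgst y us r pr vs bs :=
  St (map orac y) (encw us ++ encw vs) (map bit bs) (rev (enc_path r (rev pr))) [::] [::].

Definition ecost e n l := 3 * (8 * l + 8) + ccost e n + 1.

Lemma exec_enter g n y us r pr pt vs bs : n <= 3 -> g :: pt = rev (enc_path r (rev pr)) ->
  if aenter us r pr n vs (bval bs) is Some (pr', vs', b') then
    exists bs', [/\ size bs' = size bs, bval bs' = b' &
    exec (enter g n) (St (map orac y) (encw us ++ encw vs) (map bit bs) pt [::] [::])
     (Some (cfgst y us r pr' vs' bs')) (ecost (size pr + 1) (size (encw us ++ encw vs)) (size bs))]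
  else exists t,
    exec (enter g n) (St (map orac y) (encw us ++ encw vs) (map bit bs) pt [::] [::]) None t.
Proof.
move=> n3 Eg; set s0 := St _ _ _ _ _ _.
have H0 : exec (push #3 g) s0
   (Some (St (map orac y) (encw us ++ encw vs) (map bit bs) (rev (enc_path r (rev pr))) [::]
       [::])) 1.
  by rewrite -Eg; exact: exec_act.
have := exec_decs n check (map orac y) (encw us ++ encw vs) bs (rev (enc_path r (rev pr))).
rewrite /aenter; case: ifP => _ /=; last by move=> [t H]; eexists; apply: exec_seq H0 H.
move=> [bs1 [S1 V1 H1]].
have := exec_check (map orac y) us vs (map bit bs1) r (rev pr).
rewrite -[all (rmatch r pr) us]/(all (fits r (rev pr)) us).
case: ifP => _; last by move=> [t /H1 H]; eexists; apply: exec_seq H0 H.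
move=> /H1 H; exists bs1; split=> //; apply: exec_le (exec_seq H0 H) _.
have : size (enc_path r (rev pr)) <= size pr + 1.
  by rewrite /enc_path size_cat size_map size_rev; case: (r) => [c|] /=; lia.
rewrite /ecost /ccost; move: (size _) (size pr) (size _) (size bs) => e l N b *; nia.
Qed.

(** * Executing a certificate *)

(** Choices are coded in unary: there are as many as the fixed alphabet dictates, so a choice has
    bounded length. *)
Fixpoint sel (cs : seq com) : com :=
  if cs is c :: cs' then If (top_is (orac true) #0) (Seq (pop #0) c) (Seq (pop #0) (sel cs'))
  else Abort _ _.

Definition choice i := nseq i false ++ [:: true].

Lemma exec_pop0 o wd kb pt :
  exec (pop #0) (St o wd kb pt [::] [::]) (Some (St (behead o) wd kb pt [::] [::])) 1.
Proof. exact: exec_act. Qed.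

Lemma exec_sel cs i (c0 : com) y wd kb pt out t : i < size cs ->
  exec (nth c0 cs i) (St (map orac y) wd kb pt [::] [::]) out t ->
  exec (sel cs) (St (map orac (choice i ++ y)) wd kb pt [::] [::]) out (2 * i + 2 + t).
Proof.
elim: cs i => //= c cs IH [|i] Hi H.
  by apply: exec_le (exec_if (t := 1 + t) _) _ => //; apply: exec_seq H; apply: exec_pop0.
apply: exec_le (exec_if (t := 1 + (2 * i + 2 + t)) _) _; last by lia.
by apply: exec_seq (IH _ Hi H); apply: exec_pop0.
Qed.

(** Soundness meets arbitrary bit strings; one that does not begin with a valid index must lead to
    an aborted run. *)
Lemma sel_total cs y wd kb pt : (exists i y', i < size cs /\ y = choice i ++ y') \/
  exists t, exec (sel cs) (St (map orac y) wd kb pt [::] [::]) None t.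
Proof.
elim: cs y => [|c cs IH] y; first by right; exists 1; apply: exec_abort.
case: y => [|[] y].
- case: (IH [::]) => [[[|i] [y' [_ //]]]|[t H]].
  right; eexists; apply: (exec_if (t := 1 + t)).
  by apply: exec_seq H; apply: exec_pop0.
- by left; exists 0, y.
- case: (IH y) => [[i [y' [Hi ->]]]|[t H]]; first by left; exists i.+1, y'.
  right; eexists; apply: (exec_if (t := 1 + t)).
  by apply: exec_seq H; apply: exec_pop0.
Qed.

Definition starts := enum {: bool * S}.

Definition start_with (x : bool * S) : com :=
  if x.1 then enter (mark x.2) 1 else enter (letter x.2) 2.

Definition init_path : com := sel [seq start_with x | x <- starts].

Lemma exec_start_with x y us vs bs :
  if astart us x vs (bval bs) is Some (pr', vs', b') then
    exists bs', [/\ size bs' = size bs, bval bs' = b' &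
    exec (start_with x) (St (map orac y) (encw us ++ encw vs) (map bit bs) [::] [::] [::])
     (Some (cfgst y us (aroot x) pr' vs' bs')) (ecost 2 (size (encw us ++ encw vs)) (size bs))]
  else exists t,
    exec (start_with x) (St (map orac y) (encw us ++ encw vs) (map bit bs) [::] [::] [::]) None t.
Proof.
case: x => [[] c]; rewrite /astart /start_with /aroot /=.
  have := @exec_enter (mark c) 1 y us (Some c) [::] [::] vs bs isT erefl.
  case: (aenter _ _ _ _ _ _) => [[[pr' vs'] b']|] // [bs' [S1 V1 H]].
  exists bs'; split=> //; apply: exec_le H _.
  by rewrite /ecost /ccost /=; move: (size _) (size bs) => *; lia.
have := @exec_enter (letter c) 2 y us None [:: c] [::] vs bs isT erefl.
by case: (aenter _ _ _ _ _ _) => [[[pr' vs'] b']|].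
Qed.

Lemma nth_start x : nth (Abort _ _) [seq start_with x | x <- starts] (index x starts) = start_with
    x.
Proof. by rewrite (nth_map x) ?nth_index ?index_mem ?mem_enum. Qed.

(** A return requires a letter on top of the path: a mark or an empty stack means that the traversal
    is at the root. *)
Definition step_cmd : com :=
  If (top_is (orac true) #0)
    (Seq (pop #0) (If (fun tp => oapp is_letter false (top 3 tp)) (pop #3) (Abort _ _)))
    (Seq (pop #0) (sel [seq enter (letter c) 3 | c <- enum S])).

Definition loop : com := While (fun tp => top 0 tp != None) step_cmd.

Definition opbits (op : option S) :=
  if op is Some c then false :: choice (index c (enum S)) else [:: true].

Lemma rev_enc_path r p : rev (enc_path r p) = map letter (rev p) ++ (if r is Some c then [:: mark
    c] else [::]).
Proof. by rewrite /enc_path rev_cat map_rev; case: r. Qed.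

Definition scost e n l := 2 * #|S| + ecost e n l + 8.

Lemma exec_step op y us r pr vs bs :
  if astep us r op (pr, vs, bval bs) is Some (pr', vs', b') then
    exists bs', [/\ size bs' = size bs, bval bs' = b' &
    exec step_cmd (cfgst (opbits op ++ y) us r pr vs bs) (Some (cfgst y us r pr' vs' bs'))
     (scost (size pr + 2) (size (encw us ++ encw vs)) (size bs))]
  else exists t, exec step_cmd (cfgst (opbits op ++ y) us r pr vs bs) None t.
Proof.
case: op => [c|].
  have E : letter c :: rev (enc_path r (rev pr)) = rev (enc_path r (rev (c :: pr))).
    by rewrite !rev_enc_path !revK.
  have := exec_enter y us vs bs (leqnn 3) E; rewrite /astep.
  set cs := [seq enter (letter c) 3 | c <- enum S].
  have Hi : index c (enum S) < size cs by rewrite size_map index_mem mem_enum.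
  have Hn : nth (Abort _ _) cs (index c (enum S)) = enter (letter c) 3.
    by rewrite (nth_map c) ?nth_index ?index_mem ?mem_enum.
  have X out t : exec (enter (letter c) 3) (St (map orac y) (encw us ++ encw vs) (map bit bs)
         (rev (enc_path r (rev pr))) [::] [::]) out t ->
       exec step_cmd (cfgst (opbits (Some c) ++ y) us r pr vs bs) out (2 * #|S| + t + 8).
    rewrite -{1}Hn => /(exec_sel Hi) H.
    apply: exec_le (exec_if (t := 1 + (2 * index c (enum S) + 2 + t)) _) _.
      by apply: exec_seq H; apply: exec_pop0.
    have : index c (enum S) <= #|S| by rewrite cardE index_size.
    by move: (index _ _) => *; lia.
  case: (aenter _ _ _ _ _ _) => [[[pr' vs'] b']|]; last by move=> [t /X H]; eexists; exact: H.
  move=> [bs' [S1 V1 /X H]]; exists bs'; split=> //; apply: exec_le H _.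
  by rewrite /scost /ecost /ccost /=; move: (size pr) (size (_ ++ _)) (size bs) => *; nia.
have X out t : exec (If (fun tp => oapp is_letter false (top 3 tp)) (pop #3) (Abort _ _))
     (cfgst y us r pr vs bs) out t ->
     exec step_cmd (cfgst (opbits None ++ y) us r pr vs bs) out (1 + t).+1.
  by move=> H; apply: exec_if; apply: exec_seq H; apply: exec_pop0.
case: pr X => [|d pr] X /=.
  eexists; apply: (X _ 2); apply: exec_if; rewrite /cfgst rev_enc_path /=.
  case: (r) => [c|] /=; exact: exec_abort.
exists bs; split=> //; apply: exec_le (X _ 2 _) _; last by rewrite /scost; lia.
apply: exec_if; rewrite /cfgst !rev_enc_path !revK /=; exact: exec_act.
Qed.

Lemma step_total y us r pr vs bs : y != [::] -> (exists op y', y = opbits op ++ y') \/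
  exists t, exec step_cmd (cfgst y us r pr vs bs) None t.
Proof.
case: y => // [[] y] _; first by left; exists None, y.
have := sel_total [seq enter (letter c) 3 | c <- enum S] y (encw us ++ encw vs) (map bit bs)
  (rev (enc_path r (rev pr))).
case=> [[i [y' [Hi ->]]]|[t H]].
  left; rewrite size_map in Hi; have [c0 _] : exists c : S, true.
    by case: (enum S) Hi => // c; exists c.
  by exists (Some (nth c0 (enum S) i)), y'; rewrite /opbits index_uniq ?enum_uniq.
right; eexists; apply: (exec_if (t := 1 + t)).
by apply: exec_seq H; apply: exec_pop0.
Qed.

Lemma start_total y us vs bs : (exists x y', y = choice (index x starts) ++ y') \/
  exists t, exec init_path (St (map orac y) (encw us ++ encw vs) (map bit bs) [::] [::] [::]) None
      t.
Proof.
have := sel_total [seq start_with x | x <- starts] y (encw us ++ encw vs) (map bit bs) [::].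
case=> [[i [y' [Hi ->]]]|[t H]]; last by right; exists t.
left; rewrite size_map in Hi; have [x0 _] : exists x : bool * S, true.
  by case: (starts) Hi => // x; exists x.
by exists (nth x0 starts i), y'; rewrite index_uniq ?enum_uniq.
Qed.

Lemma exec_init_path x y us vs bs :
  if astart us x vs (bval bs) is Some (pr', vs', b') then
    exists bs', [/\ size bs' = size bs, bval bs' = b' &
    exec init_path (St (map orac (choice (index x starts) ++ y)) (encw us ++ encw vs)
        (map bit bs) [::] [::] [::])
     (Some (cfgst y us (aroot x) pr' vs' bs'))
     (2 * #|{: bool * S}| + ecost 2 (size (encw us ++ encw vs)) (size bs) + 2)]
  else exists t,
    exec init_path (St (map orac (choice (index x starts) ++ y)) (encw us ++ encw vs)
      (map bit bs) [::] [::] [::]) None t.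
Proof.
have Hi : index x starts < size [seq start_with x | x <- starts].
  by rewrite size_map index_mem mem_enum.
have := exec_start_with x y us vs bs; rewrite -nth_start.
case: (astart _ _ _ _) => [[[pr' vs'] b']|].
  move=> [bs' [S1 V1 /(exec_sel Hi) H]]; exists bs'; split=> //; apply: exec_le H _.
  have : index x starts <= #|{: bool * S}| by rewrite cardE index_size.
  by move: (index _ _) (ecost _ _ _) => *; lia.
by move=> [t /(exec_sel Hi) H]; eexists; exact: H.
Qed.

Lemma arun_cons us r op os st :
  arun us r (op :: os) st = obind (arun us r os) (astep us r op st).
Proof. by []. Qed.

Definition cert (os : seq (option S)) := flatten (map opbits os).

Lemma top_opbits op y us r pr vs bs :
  (fun tp => top 0 tp != None) (tops (cfgst (opbits op ++ y) us r pr vs bs)).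
Proof. by case: op. Qed.

Lemma size_encw_filter (P : pred (seq S)) us vs :
  size (encw us ++ encw (filter P vs)) <= size (encw us ++ encw vs).
Proof. by rewrite !size_cat leq_add2l !size_rcons ltnS size_body_filter. Qed.

Lemma astep_size us r op pr vs b pr' vs' b' : astep us r op (pr, vs, b) = Some (pr', vs', b') ->
  size pr' <= size pr + 1 /\ size (encw us ++ encw vs') <= size (encw us ++ encw vs).
Proof.
case: op => [c|] /=; last by case: pr => // d pr [<- <- _]; rewrite /=; split; lia.
rewrite /aenter; case: ifP => // _ [<- <- _] /=; rewrite addn1; split=> //.
exact: size_encw_filter.
Qed.

Lemma scost_le e e' n n' l : e <= e' -> n <= n' -> scost e n l <= scost e' n' l.
Proof.
move=> He Hn; rewrite /scost /ecost /ccost leq_add2r leq_add2l leq_add2r leq_add2l.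
by rewrite leq_mul ?leq_mul2l ?leq_add2r ?He ?orbT.
Qed.

(** A move lengthens the path by at most one and never enlarges the word lists, so [e] and [n] bound
    both along the whole run and every round has the same cost. *)
Lemma exec_loop os us r pr vs bs pr' vs' b' e n :
  arun us r os (pr, vs, bval bs) = Some (pr', vs', b') ->
  size pr + size os + 1 <= e -> size (encw us ++ encw vs) <= n ->
  exists bs', [/\ size bs' = size bs, bval bs' = b' &
    exec loop (cfgst (cert os) us r pr vs bs) (Some (cfgst [::] us r pr' vs' bs'))
      ((scost e n (size bs)).+1 * size os + 1)].
Proof.
elim: os pr vs bs => [|op os IH] pr vs bs.
  by move=> [<- <- <-] _ _; exists bs; split=> //; rewrite muln0; apply: exec_while_end.
rewrite arun_cons => R He Hn; move: R.
have := exec_step op (cert os) us r pr vs bs.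
case E : (astep _ _ _ _) => [[[pr1 vs1] b1]|] //= [bs1 [S1 V1 H1]]; subst b1 => R.
have [Lp Ln] := astep_size E.
have [||bs2 [S2 V2 H2]] := IH _ _ _ R.
- by move: He => /=; move: (size pr) (size pr1) (size os) Lp => *; lia.
- exact: leq_trans Ln Hn.
exists bs2; split; [by rewrite S2|by []|].
apply: exec_le (exec_while (top_opbits _ _ _ _ _ _ _) H1 H2) _.
rewrite S1; have : scost (size pr + 2) (size (encw us ++ encw vs)) (size bs) <= scost e n (size bs).
  by apply: scost_le => //; move: He => /=; move: (size pr) (size os) => *; lia.
by move: (scost _ _ _) (scost _ _ _) => *; nia.
Qed.

(** Each round consumes at least one bit, so the loop ends on every bit string; a run that does not
    abort has decoded a sequence of operations. *)
Lemma loop_total y us r pr vs bs : exists out t,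
  exec loop (cfgst y us r pr vs bs) out t /\
  (out = None \/ exists os pr' vs' bs',
    arun us r os (pr, vs, bval bs) = Some (pr', vs', bval bs') /\
    out = Some (cfgst [::] us r pr' vs' bs')).
Proof.
have [n] := ubnP (size y); elim: n y pr vs bs => // n IH y pr vs bs Hy.
have [->|y0] := eqVneq y [::].
  exists (Some (cfgst [::] us r pr vs bs)), 1; split; first exact: exec_while_end.
  by right; exists [::], pr, vs, bs.
have [[op [y' E]]|[t H]] := step_total us r pr vs bs y0; last first.
  exists None, t.+1; split; last by left.
  by apply: exec_while_abort H; case: (y) y0.
have := exec_step op y' us r pr vs bs; rewrite -E.
have T0 : (fun tp => top 0 tp != None) (tops (cfgst y us r pr vs bs)) by case: (y) y0.
case R : (astep _ _ _ _) => [[[pr1 vs1] b1]|]; last first.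
  by move=> [t H]; exists None, t.+1; split; [apply: exec_while_abort H|left].
move=> [bs1 [S1 V1 H1]]; subst b1.
have [|out [t [H2 Ho]]] := IH y' pr1 vs1 bs1.
  by move: Hy; rewrite E size_cat; case: (op) => [c|] /=; move: (size _) => *; lia.
exists out, (scost (size pr + 2) (size (encw us ++ encw vs)) (size bs) + t).+1; split.
  exact: exec_while H1 H2.
case: Ho => [->|[os [pr' [vs' [bs' [Ra ->]]]]]]; first by left.
by right; exists (op :: os), pr', vs', bs'; rewrite arun_cons R.
Qed.

(** Behind the [eol] that closes the positive words, a second [eol] must follow at once: no negative
    word is left. *)
Definition final : com :=
  Seq (movwhile (predC1 eol) #1 #5) (Seq (mov #1 #5) (If (top_is eol #1) skip (Abort _ _))).

Lemma body_no_eol ws : all (predC1 eol) (body ws).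
Proof.
elim: ws => // w ws IH; rewrite body_cons all_cat /= eow_eol; apply/andP; split=> //.
by apply/allP => g /mapP[c _ ->].
Qed.

Lemma exec_final us r pr vs bs :
  if vs == [::] then exists s, exec final (cfgst [::] us r pr vs bs) (Some s)
    (3 * size (encw us ++ encw vs) + 10)
  else exists t, exec final (cfgst [::] us r pr vs bs) None t.
Proof.
set W := encw us ++ encw vs; set P := rev (enc_path r (rev pr)).
have H1 : exec (movwhile (predC1 eol) #1 #5) (St [::] W (map bit bs) P [::] [::])
    (Some (St [::] (eol :: body vs ++ [:: eol]) (map bit bs) P [::] (catrev (body us) [::])))
    (3 * size (body us) + 1).
  apply: (@exec_movwhile _ #1 #5 (St [::] W (map bit bs) P [::] [::])) => //.
  - by rewrite /W encw_cat.
  - exact: body_no_eol.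
  - by rewrite /= eqxx.
have H2 := exec_mov15 [::] eol (body vs ++ [:: eol]) (map bit bs) P [::] (catrev (body us) [::]).
case: eqP => [E|/eqP E].
  eexists; apply: exec_le (exec_seq H1 (exec_seq H2 (exec_if (t := 1) _))) _.
    by rewrite /top_is E /= eqxx; exact: exec_skip.
  by rewrite /W encw_cat size_cat; move: (size _) (size _) => *; lia.
eexists; apply: (exec_seq H1 (exec_seq H2 (exec_if (t := 1) _))).
rewrite /top_is; case: (vs) E => // w vs' _.
have := body_top w vs' [:: eol]; rewrite /=; case: (ohead _) => //= g gne.
by rewrite (inj_eq Some_inj) (negPf gne); exact: exec_abort.
Qed.

(** * Parsing the input *)

Definition pword (cnt : com) : com :=
  If (fun tp => oapp is_letter false (top 0 tp))
    (Seq (movwhile is_letter #0 #5) (If (top_is eow #0) (Seq (mov #0 #5) cnt) (Abort _ _)))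
    (Abort _ _).

Definition pwords (cnt : com) : com :=
  Seq (While (fun tp => top 0 tp != Some eol) (pword cnt)) (mov #0 #5).

(** Stack 3 is a unary counter, raised by positive words and lowered by negative ones, which
    compares the lengths of the two lists. [f] is the effect on it; [None] is an underflow, which
    aborts. *)
Definition counts (f : stack -> option stack) (cnt : com) := forall o pt xt,
  exec cnt (St o [::] [::] pt [::] xt) (omap (fun pt' => St o [::] [::] pt' [::] xt) (f pt)) 2.

Definition count_up : com := push #3 eow.
Definition count_down : com := If (fun tp => top 3 tp != None) (pop #3) (Abort _ _).

Lemma counts_up : counts (fun pt => Some (eow :: pt)) count_up.
Proof. by move=> o pt xt; apply: exec_le (exec_act _ _) _. Qed.

Lemma counts_down : counts (fun pt => if pt is _ :: pt' then Some pt' else None) count_down.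
Proof.
move=> o [|g pt] xt; apply: exec_if => /=; [exact: exec_abort|exact: exec_act].
Qed.

Lemma exec_mov05 o g wd kb pt tt xt :
  exec (mov #0 #5) (St (g :: o) wd kb pt tt xt) (Some (St o wd kb pt tt (g :: xt))) 2.
Proof. exact: exec_mov. Qed.

Lemma exec_letters05 o w pt xt : ~~ oapp is_letter false (ohead o) ->
  exec (movwhile is_letter #0 #5) (St (map letter w ++ o) [::] [::] pt [::] xt)
    (Some (St o [::] [::] pt [::] (catrev (map letter w) xt))) (3 * size w + 1).
Proof.
move=> Ho; rewrite -[size w](size_map letter).
apply: (@exec_movwhile is_letter #0 #5 (St _ [::] [::] pt [::] xt)) => //.
by apply/allP => g /mapP[c _ ->].
Qed.

Section Count.
Variables (f : stack -> option stack) (cnt : com).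
Hypothesis Hcnt : counts f cnt.

Lemma exec_pword o w pt xt : w != [::] ->
  exec (pword cnt) (St (map letter w ++ eow :: o) [::] [::] pt [::] xt)
    (omap (fun pt' => St o [::] [::] pt' [::] (eow :: catrev (map letter w) xt)) (f pt))
    (3 * size w + 10).
Proof.
move=> w0; have H1 := @exec_letters05 (eow :: o) w pt xt isT.
have H2 := exec_mov05 o eow [::] [::] pt [::] (catrev (map letter w) xt).
have H3 := @Hcnt o pt (eow :: catrev (map letter w) xt).
apply: exec_le (exec_if (t := 3 * size w + 1 + 5) _) _; last by lia.
rewrite ifT; last by case: (w) w0.
apply: (exec_seq H1); apply: exec_if; rewrite /top_is /= eqxx; exact: exec_seq H2 H3.
Qed.

Lemma split_letters o : exists w o', o = map letter w ++ o' /\ ~~ oapp is_letter false (ohead o').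
Proof.
elim: o => [|g o [w [o' [-> H]]]]; first by exists [::], [::].
have [|n] := boolP (is_letter g); last by exists [::], (g :: map letter w ++ o').
by case: g => [[[c|//]|//]|//] _; exists (c :: w), o'.
Qed.

Lemma pword_total o pt xt : (exists w o', w != [::] /\ o = map letter w ++ eow :: o') \/
  exists t, exec (pword cnt) (St o [::] [::] pt [::] xt) None t.
Proof.
have [w [o' [-> Ho]]] := split_letters o.
have [->|w0] := eqVneq w [::].
  right; eexists; apply: (exec_if (t := 1)); rewrite /= (negPf Ho); exact: exec_abort.
have [/eqP E|ne] := boolP (ohead o' == Some eow).
  by left; exists w, (behead o'); split=> //; case: (o') E => // g o1 [->].
right; eexists; apply: exec_if; rewrite ifT; last by case: (w) w0.
apply: (exec_seq (exec_letters05 w pt xt Ho) (exec_if (t := 1) _)).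
rewrite /top_is /= (negPf ne); exact: exec_abort.
Qed.

Lemma iter_none n : iter n (obind f) None = None.
Proof. by elim: n => //= n ->. Qed.

Lemma exec_pwords o ws pt xt pt' : all (fun w => w != [::]) ws ->
  iter (size ws) (obind f) (Some pt) = Some pt' ->
  exec (pwords cnt) (St (encw ws ++ o) [::] [::] pt [::] xt)
    (Some (St o [::] [::] pt' [::] (catrev (encw ws) xt))) (11 * size (encw ws)).
Proof.
move=> Hne Hit.
have H1 : exec (While (fun tp => top 0 tp != Some eol) (pword cnt))
   (St (body ws ++ eol :: o) [::] [::] pt [::] xt)
   (Some (St (eol :: o) [::] [::] pt' [::] (catrev (body ws) xt))) (11 * size (body ws) + 1).
  elim: ws pt xt Hne Hit => [|w ws IH] pt xt /=.
    by move=> _ [<-]; apply: exec_while_end; rewrite /= eqxx.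
  move=> /andP[w0 Hne]; rewrite -iterS iterSr /=.
  have := @exec_pword (body ws ++ eol :: o) w pt xt w0.
  case: (f pt) => [pt1|]; last by rewrite iter_none.
  move=> H1 /(IH _ (eow :: catrev (map letter w) xt) Hne) H2.
  rewrite body_cons catrev_catl -catA.
  apply: exec_le (exec_while _ H1 H2) _; first by case: (w) w0.
  by rewrite size_cat /= size_map; move: (size w) (size (body ws)) => *; lia.
have H2 := exec_mov05 o eol [::] [::] pt' [::] (catrev (body ws) xt).
rewrite /encw cat_rcons -cats1 catrev_catl size_cat addn1 mulnS.
by apply: exec_le (exec_seq H1 H2) _; move: (size _) => *; lia.
Qed.

Lemma pwords_total o pt xt : (exists ws o' pt', [/\ all (fun w => w != [::]) ws,
    iter (size ws) (obind f) (Some pt) = Some pt' & o = encw ws ++ o']) \/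
  exists t, exec (pwords cnt) (St o [::] [::] pt [::] xt) None t.
Proof.
suff [H|[t H]] : (exists ws o' pt', [/\ all (fun w => w != [::]) ws,
    iter (size ws) (obind f) (Some pt) = Some pt' & o = encw ws ++ o']) \/
  exists t, exec (While (fun tp => top 0 tp != Some eol) (pword cnt))
   (St o [::] [::] pt [::] xt) None t.
- by left.
- by right; exists t; apply: exec_seq_abort.
have [n] := ubnP (size o); elim: n o pt xt => // n IH o pt xt Ho.
have [/eqP E|ne] := boolP (ohead o == Some eol).
  by left; exists [::], (behead o), pt; split=> //; case: (o) E => // g o1 [->].
have [[w [o' [w0 E]]]|[t H]] := pword_total o pt xt; last first.
  by right; eexists; apply: exec_while_abort H.
have := @exec_pword o' w pt xt w0; rewrite -E.
case Ef : (f pt) => [pt1|] /= H; last by right; eexists; apply: exec_while_abort H.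
have [|[ws [o1 [pt' [Hne Hit E1]]]]|[t H2]] := IH o' pt1 (eow :: catrev (map letter w) xt).
- by move: Ho; rewrite E size_cat /=; move: (size _) (size _) => *; lia.
- left; exists (w :: ws), o1, pt'; split; first by rewrite /= w0.
    by rewrite [size _]/= iterSr /= Ef.
  by rewrite E E1 /encw body_cons rcons_cat /= -catA.
- by right; eexists; apply: exec_while H H2.
Qed.
End Count.

Definition is_bit g := (g == bit true) || (g == bit false).

Definition pbits : com :=
  While (fun tp => top 0 tp != Some sep)
    (If (fun tp => oapp is_bit false (top 0 tp)) (mov #0 #5) (Abort _ _)).

Lemma is_bitP b : is_bit (bit b).
Proof. by rewrite /is_bit !bit_eq; case: b. Qed.

Lemma exec_pbits o bs xt pt :
  exec pbits (St (map bit bs ++ sep :: o) [::] [::] pt [::] xt)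
    (Some (St (sep :: o) [::] [::] pt [::] (catrev (map bit bs) xt))) (4 * size bs + 1).
Proof.
elim: bs xt => [|b bs IH] xt; first by apply: exec_while_end; rewrite /= ?eqxx.
have H := exec_mov05 (map bit bs ++ sep :: o) (bit b) [::] [::] pt [::] xt.
apply: exec_le (exec_while _ (exec_if (t := 2) _) (IH _)) _ => //.
  by rewrite /= is_bitP.
by rewrite /=; move: (size bs) => *; lia.
Qed.

Lemma pbits_total o pt xt : (exists bs o', o = map bit bs ++ sep :: o') \/
  exists t, exec pbits (St o [::] [::] pt [::] xt) None t.
Proof.
elim: o xt => [|g o IH] xt.
  right; eexists; apply: exec_while_abort => //; apply: (exec_if (t := 1)); exact: exec_abort.
have [->|gs] := eqVneq g sep; first by left; exists [::], o.
have T0 : (fun tp => top 0 tp != Some sep) (tops (St (g :: o) [::] [::] pt [::] xt)).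
  by rewrite /= (inj_eq Some_inj).
have [gb|gb] := boolP (is_bit g); last first.
  right; eexists; apply: exec_while_abort => //; apply: (exec_if (t := 1)).
  rewrite /= (negPf gb); exact: exec_abort.
have H : exec (If (fun tp => oapp is_bit false (top 0 tp)) (mov #0 #5) (Abort _ _))
    (St (g :: o) [::] [::] pt [::] xt) (Some (St o [::] [::] pt [::] (g :: xt))) 3.
  by apply: exec_if; rewrite /= gb; exact: exec_mov05.
case: (IH (g :: xt)) => [[bs [o' ->]]|[t H2]]; last first.
  by right; eexists; apply: exec_while T0 H H2.
by left; case/orP: gb => /eqP->; [exists (true :: bs)|exists (false :: bs)]; exists o'.
Qed.

(** Only inputs produced by [encode] may pass. When [sep] is reached, the most significant bit is on
    top of stack 5, and a zero there is refused because [bin] has no leading zeros; if there are no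
    bits, the top is [eol]. *)
Definition parse : com :=
  Seq (pwords count_up) (Seq (pwords count_down)
   (Seq (If (fun tp => top 3 tp == None) skip (Abort _ _)) (Seq pbits
   (Seq (If (top_is (bit false) #5) (Abort _ _) skip) (Seq (pop #0)
   (Seq (movwhile is_bit #5 #2) (movwhile predT #5 #1))))))).

Lemma iter_up n pt : iter n (obind (fun pt => Some (eow :: pt))) (Some pt) = Some (nseq n eow ++
    pt).
Proof. by elim: n => //= n ->. Qed.

Lemma iter_down n m :
  iter n (obind (fun pt : stack => if pt is _ :: pt' then Some pt' else None)) (Some (nseq m eow))
  = if n <= m then Some (nseq (m - n) eow) else None.
Proof.
elim: n m => [|n IH] m; first by rewrite subn0.
rewrite iterSr /=; case: m => [|m] /=; first by rewrite iter_none.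
by rewrite IH.
Qed.

Lemma top_last bs o wd kb pt tt xt :
  top_is (bit false) #5 (tops (St o wd kb pt tt (catrev (map bit bs) (eol :: xt))))
  = ~~ last true bs.
Proof.
case/lastP: bs => [|bs b]; rewrite /top_is /=; first exact: eol_bit.
by rewrite map_rcons -cats1 catrev_catl last_rcons -eqbF_neg -bit_eq.
Qed.

Lemma exec_parse us vs bs o :
  all (fun w => w != [::]) us -> all (fun w => w != [::]) vs -> size us = size vs -> last true bs ->
  exec parse (St (encw us ++ encw vs ++ map bit bs ++ sep :: o) [::] [::] [::] [::] [::])
    (Some (St o (encw us ++ encw vs) (map bit bs) [::] [::] [::]))
    (20 * (size (encw us) + size (encw vs) + size bs) + 20).
Proof.
move=> Hu Hv Huv Hl.
have H1 := exec_pwords counts_up (encw vs ++ map bit bs ++ sep :: o) [::] Hu (iter_up _ [::]).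
rewrite cats0 in H1.
have := iter_down (size vs) (size us); rewrite Huv leqnn subnn => It.
have H2 := exec_pwords counts_down (map bit bs ++ sep :: o) (catrev (encw us) [::]) Hv It.
rewrite -Huv in H2.
set X := catrev (encw vs) _ in H2.
have H3 : exec (If (fun tp => top 3 tp == None) skip (Abort _ _))
  (St (map bit bs ++ sep :: o) [::] [::] [::] [::] X)
  (Some (St (map bit bs ++ sep :: o) [::] [::] [::] [::] X)) 2 by apply: exec_if; exact: exec_skip.
have H4 := exec_pbits o bs X [::].
set X' := catrev _ X in H4.
have EX : X = eol :: behead X by rewrite /X /encw -cats1 catrev_catl.
have H5 : exec (If (top_is (bit false) #5) (Abort _ _) skip)
  (St (sep :: o) [::] [::] [::] [::] X') (Some (St (sep :: o) [::] [::] [::] [::] X')) 2.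
  apply: exec_if; rewrite /X' EX top_last Hl; exact: exec_skip.
have H6 := exec_act (fun _ => APop _ #0) (St (sep :: o) [::] [::] [::] [::] X').
have H7 : exec (movwhile is_bit #5 #2) (St o [::] [::] [::] [::] X')
   (Some (St o [::] (map bit bs) [::] [::] X)) (3 * size bs + 1).
  have := @exec_movwhile is_bit #5 #2 (St o [::] [::] [::] [::] X') (rev (map bit bs)) X.
  rewrite size_rev size_map catrevE revK cats0; apply=> //; first by rewrite /X' catrevE.
    by apply/allP => g; rewrite mem_rev => /mapP[b _ ->]; apply: is_bitP.
  by rewrite EX /= /is_bit !eol_bit.
have H8 : exec (movwhile predT #5 #1) (St o [::] (map bit bs) [::] [::] X)
   (Some (St o (encw us ++ encw vs) (map bit bs) [::] [::] [::])) (3 * size X + 1).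
  have -> : encw us ++ encw vs = catrev X [::].
    by rewrite /X !catrevE !cats0 rev_cat !revK.
  apply: (@exec_movwhile predT #5 #1 (St o [::] (map bit bs) [::] [::] X)) => //.
    by rewrite /= cats0.
  exact: all_predT.
apply: exec_le (exec_seq H1 (exec_seq H2 (exec_seq H3 (exec_seq H4 (exec_seq H5 (exec_seq H6
    (exec_seq H7 H8))))))) _.
have -> : size X = size (encw us) + size (encw vs).
  by rewrite /X !catrevE cats0 size_cat !size_rev addnC.
by move: (size (encw us)) (size (encw vs)) (size bs) => *; lia.
Qed.

Lemma parse_total o0 :
  (exists us vs bs o, [/\ all (fun w => w != [::]) (us ++ vs), size us = size vs, last true bs &
     o0 = encw us ++ encw vs ++ map bit bs ++ sep :: o]) \/
  exists t, exec parse (St o0 [::] [::] [::] [::] [::]) None t.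
Proof.
case: (pwords_total counts_up o0 [::] [::]) => [[us [o1 [pt1 [Hu It1 E1]]]]|[t H]]; last first.
  by right; eexists; apply: exec_seq_abort H.
have H1 := exec_pwords counts_up o1 [::] Hu It1.
rewrite iter_up cats0 in It1; case: It1 => It1; subst pt1 o0.
set X1 := catrev _ _ in H1.
case: (pwords_total counts_down o1 (nseq (size us) eow) X1) => [[vs [o2 [pt2 [Hv It2 E2]]]]|[t
    H]]; last first.
  by right; eexists; apply: exec_seq H1 (exec_seq_abort _ H).
have H2 := exec_pwords counts_down o2 X1 Hv It2.
rewrite iter_down in It2; case: ifP It2 => // Luv [E]; subst pt2 o1.
set X2 := catrev _ _ in H2.
have [Euv|Nuv] := eqVneq (size us) (size vs); last first.
  right; eexists; apply: (exec_seq H1 (exec_seq H2 (exec_seq_abort _ (exec_if (t := 1) _)))).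
  rewrite /=; have -> : size us - size vs = (size us - size vs).-1.+1 by move: Nuv Luv => /eqP; lia.
  exact: exec_abort.
have H3 : exec (If (fun tp => top 3 tp == None) skip (Abort _ _))
  (St o2 [::] [::] (nseq (size us - size vs) eow) [::] X2)
  (Some (St o2 [::] [::] [::] [::] X2)) 2.
  by rewrite Euv subnn; apply: exec_if; exact: exec_skip.
case: (pbits_total o2 [::] X2) => [[bs [o3 E]]|[t H]]; last first.
  by right; eexists; apply: (exec_seq H1 (exec_seq H2 (exec_seq H3 (exec_seq_abort _ H)))).
subst o2; have H4 := exec_pbits o3 bs X2 [::].
have [Hl|Hl] := boolP (last true bs); last first.
  right; eexists; apply: (exec_seq H1 (exec_seq H2 (exec_seq H3 (exec_seq H4 (exec_seq_abort _
      (exec_if (t := 1) _)))))).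
  have EX : X2 = eol :: behead X2 by rewrite /X2 /encw -cats1 catrev_catl.
  rewrite EX top_last Hl; exact: exec_abort.
by left; exists us, vs, bs, o3; rewrite all_cat Hu.
Qed.

(** * Correctness of the verifier *)

Definition verifier : com := Seq parse (Seq init_path (Seq loop final)).

Definition embed (x : tok S) : gam := inl (inl x).

Lemma embed_words ws : map embed (enc_words ws) = encw ws.
Proof.
rewrite /enc_words map_cat /encw -cats1; congr (_ ++ _).
elim: ws => //= w ws IH; rewrite map_cat IH body_cons map_rcons -map_comp.
by rewrite -cats1 -catA.
Qed.

Lemma embed_encode us vs k : map embed (encode us vs k) = encw us ++ encw vs ++ map bit (bin k).
Proof. by rewrite /encode map_cat embed_words map_cat embed_words -map_comp. Qed.

Lemma init_vinput (x : seq (tok S)) y :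
  map (@inl _ S) (vinput x y) :: nseq 5 [::] =
  St (map embed x ++ sep :: map orac y) [::] [::] [::] [::] [::].
Proof. by rewrite /vinput map_cat /= -!map_comp. Qed.

(** [sep] is not an embedded token, so its first occurrence separates input and certificate
    unambiguously. *)
Lemma embed_sep (x z : seq (tok S)) o1 o2 :
  map embed x ++ sep :: o1 = map embed z ++ sep :: o2 -> x = z /\ o1 = o2.
Proof. by elim: x z => [|a x IH] [|b z] //= [] => [//|-> /IH[-> ->]]. Qed.

Lemma bits_fuel0 n : bits_fuel n 0 = [::]. Proof. by case: n. Qed.

Lemma bval_bits_fuel n k : k <= n -> bval (bits_fuel n k) = k.
Proof.
elim: n k => [|n IH] k /=; first by case: k.
case: eqP => [->//|/eqP k0] kn; rewrite /= IH.
  by rewrite mul2n odd_double_half.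
by have := odd_double_half k; rewrite -mul2n; move: k0 kn; case: (odd k); lia.
Qed.

Lemma bval_bin k : bval (bin k) = k. Proof. exact: bval_bits_fuel. Qed.

Lemma last_bits_fuel n k b : 0 < k <= n -> last b (bits_fuel n k).
Proof.
elim: n k b => [|n IH] k b /=; first by lia.
case: eqP => [->//|_] /andP[k0 kn] /=.
have [h0|h0] := posnP k./2.
  rewrite h0 bits_fuel0 /=; have := odd_double_half k; rewrite h0 addn0.
  by case: (odd k) => // E; rewrite -E in k0.
by apply: IH; have := odd_double_half k; rewrite -mul2n; case: (odd k); lia.
Qed.

Lemma last_bin k : last true (bin k).
Proof. by case: k => // k; apply: last_bits_fuel; rewrite leqnn. Qed.

(** A bit string without leading zeros is the expansion of its own value, so a successfully parsed
    input is literally an [encode]. *)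
Lemma bits_fuel_bval bs n : last true bs -> bval bs <= n -> bits_fuel n (bval bs) = bs.
Proof.
elim: bs n => [|b bs IH] n Hl; first by rewrite bits_fuel0.
have pos : 0 < bval (b :: bs).
  move: Hl; rewrite /=; elim: (bs) (b) => [|b1 bs1 IH1] b0 /=; first by case: b0.
  by move/IH1; lia.
have Hl' : last true bs by case: (bs) Hl.
case: n => [|n] H; first by move: pos H; rewrite /=; lia.
rewrite [bits_fuel _ _]/= ifF; last by apply/negbTE; rewrite -lt0n.
have -> : odd (b + 2 * bval bs) = b by rewrite mul2n oddD odd_double addbF; case: (b).
have -> : (b + 2 * bval bs)./2 = bval bs by rewrite mul2n half_bit_double.
by rewrite IH //; move: pos H; rewrite /=; lia.
Qed.

(** A finished run exists for every certificate, so acceptance by the machine excludes the aborted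
    outcome and leaves a separating formula. *)
Lemma verifier_total (x : seq (tok S)) y : exists out t,
  exec verifier (map (@inl _ S) (vinput x y) :: nseq 5 [::]) out t /\
  (out <> None -> LTL_learning_lang x).
Proof.
rewrite init_vinput; set o0 := _ ++ _.
have [[us [vs [bs [o [Hne Huv Hl E]]]]]|[t H]] := parse_total o0; last first.
  by exists None, t; split=> //; apply: exec_seq_abort.
have [Ex Eo] : x = encode us vs (bval bs) /\ map orac y = o.
  apply: embed_sep; rewrite -/o0 E embed_encode /bin bits_fuel_bval //.
  by rewrite !catA.
move: (Hne); rewrite all_cat => /andP[Hu Hv].
have H1 := exec_parse o Hu Hv Huv Hl; rewrite -E in H1; subst o.
have [[s [y' Ey]]|[t H2]] := start_total y us vs bs; last first.
  by exists None; eexists; split; last by []; apply: exec_seq H1 (exec_seq_abort _ H2).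
have := exec_init_path s y' us vs bs; rewrite -Ey.
case Est : (astart _ _ _ _) => [[[pr1 vs1] b1]|]; last first.
  by move=> [t H2]; exists None; eexists; split; last by [];
      apply: exec_seq H1 (exec_seq_abort _ H2).
move=> [bs1 [S1 V1 H2]]; subst b1.
have [out [t3 [H3 Ho]]] := loop_total y' us (aroot s) pr1 vs1 bs1.
case: Ho => [Eo|[os [pr2 [vs2 [bs2 [R Eo]]]]]]; subst out.
  by exists None; eexists; split; last by [];
      apply: exec_seq H1 (exec_seq H2 (exec_seq_abort _ H3)).
have := exec_final us (aroot s) pr2 vs2 bs2; case: eqP => [E2|_]; last first.
  by move=> [t H4]; exists None; eexists; split; last by [];
      apply: exec_seq H1 (exec_seq H2 (exec_seq H3 H4)).
move=> [s' H4]; exists (Some s'); eexists; split.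
  by apply: exec_seq H1 (exec_seq H2 (exec_seq H3 H4)).
move=> _; exists us, vs, (bval bs); split=> //.
have Hpos w : w \in us ++ vs -> 0 < size w.
  by move/(allP Hne); case: w.
split; first by split.
rewrite E2 in R; have [phi [Hk Pos Neg]] := arun_sound Est R.
exists phi; split=> //; split=> [u Hin|v Hin].
  by apply/modelsP; [apply: Hpos; rewrite mem_cat Hin|apply: Pos].
have Hv0 : 0 < size v by apply: Hpos; rewrite mem_cat Hin orbT.
by move/(modelsP phi Hv0) => M; have := Neg _ Hin; rewrite M.
Qed.

(** * Length and time bounds *)

(** The bound of [arun_complete], with the input length in place of both the length of a positive
    word and the number of negative words. *)
Definition run_length n := 4 * n * n + 1.

(** A unary start choice, then at most [#|S| + 2] bits per move: a leading bit and a unary letter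
    index. *)
Definition cert_length n := #|{: bool * S}| + 1 + (#|S| + 2) * run_length n.

Definition run_time n :=
  (20 * n + 20) + ((2 * #|{: bool * S}| + ecost 2 n n + 2) +
    (((scost (run_length n + 2) n n).+1 * run_length n + 1) + (3 * n + 10))).

Lemma size_body_words ws : size ws <= size (body ws).
Proof. by elim: ws => // w ws; rewrite body_cons size_cat /=; lia. Qed.

Lemma size_word_body w ws : w \in ws -> size w <= size (body ws).
Proof.
elim: ws => // w' ws IH; rewrite body_cons size_cat size_map inE => /orP[/eqP<-|/IH] /=.
  by rewrite leq_addr.
by move: (size w) (size w') (size (body ws)) => *; lia.
Qed.

Lemma ecost_le e n n' l l' : n <= n' -> l <= l' -> ecost e n l <= ecost e n' l'.
Proof.
move=> Hn Hl; rewrite /ecost /ccost leq_add2r leq_add ?leq_mul ?leq_add2r //.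
by rewrite leq_mul2l Hl orbT.
Qed.

Lemma size_cert os : size (cert os) <= (#|S| + 2) * size os.
Proof.
elim: os => // op os IH; rewrite /cert /= size_cat -/(cert os) mulnS leq_add //.
case: op => [c|] //=; last by rewrite addn2.
rewrite size_cat size_nseq /= cardE; have := index_size c (enum S).
by move: (index _ _) (size _) => *; lia.
Qed.

Lemma verifier_complete (x : seq (tok S)) : LTL_learning_lang x ->
  exists y s, size y <= cert_length (size x) /\
    exec verifier (map (@inl _ S) (vinput x y) :: nseq 5 [::]) (Some s) (run_time (size x)).
Proof.
move=> [us [vs [k [Ex [[Huv Hpos] [phi [Hk [Pos Neg]]]]]]]].
have Sx : size x = size (encw us) + size (encw vs) + size (bin k).
  by rewrite -(size_map embed) Ex embed_encode !size_cat size_map addnA.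
set n := size x in Sx *; set bs := bin k in Sx *.
have n1 : size us <= n by rewrite Sx /encw size_rcons; have := size_body_words us;
    move: (size _) (size _) (size _) (size _) => *; lia.
have HD : vs != [::] -> exists2 w, w \in us & size w <= n.
  case Eu : us => [|w us']; first by move: Huv; rewrite Eu; case: (vs).
  move=> _; exists w; rewrite ?inE ?eqxx // Sx /encw size_rcons.
  have : size w <= size (body us) by apply: size_word_body; rewrite Eu inE eqxx.
  by move: (size w) (size _) (size _) (size _) => *; lia.
(* Every formula contains a letter, so the alphabet is inhabited. *)
have c0 : S by elim: (phi).
have [|||s [st [os [pr2 [b2 [R1 R2 L]]]]]] := @arun_complete S us vs k n phi HD c0 _ Hk.
- by move/eqP => E; move: Huv; rewrite E; case: (vs).
- by move=> w Hw; apply/modelsP; [apply: Hpos; rewrite mem_cat Hw|apply: Pos].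
- move=> v Hv; apply/negP => H; apply: (Neg v Hv); apply/modelsP => //.
  by apply: Hpos; rewrite mem_cat Hv orbT.
case: st R1 R2 => [[pr1 vs1] b1] R1 R2.
have Los : size os <= run_length n.
  by apply: leq_trans L _; rewrite leq_add2r leq_mul2l -Huv n1 orbT.
exists (choice (index s starts) ++ cert os).
have Hne : all (fun w => w != [::]) (us ++ vs).
  by apply/allP => w /Hpos; case: w.
rewrite all_cat in Hne; case/andP: Hne => Hu Hv.
have H1 := exec_parse (map orac (choice (index s starts) ++ cert os)) Hu Hv Huv (last_bin k).
have := exec_init_path s (cert os) us vs bs; rewrite bval_bin R1 => [[bs1 [S1 V1 H2]]].
subst b1; have Lp : size pr1 <= 1.
  by move: R1; rewrite /astart /aenter; case: (s.1); case: ifP => // _ [<-].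
have Lv : size (encw us ++ encw vs) <= n by rewrite Sx size_cat leq_addr.
have Lv1 : size (encw us ++ encw vs1) <= n.
  apply: leq_trans Lv; move: R1; rewrite /astart /aenter; case: (s.1); case: ifP => // _ [_ <- _];
      exact: size_encw_filter.
have Lb : size bs <= n by rewrite Sx leq_addl.
have He : size pr1 + size os + 1 <= run_length n + 2.
  by move: Lp Los; move: (size pr1) (size os) => *; lia.
have [bs2 [S2 V2 H3]] := exec_loop R2 He Lv1.
have [s' H4] := exec_final us (aroot s) pr2 [::] bs2.
exists s'; split.
  rewrite size_cat /choice size_cat size_nseq /cert_length /=; apply: leq_add.
    by rewrite leq_add2r cardE index_size.
  by apply: leq_trans (size_cert os) _; rewrite leq_mul2l Los orbT.
have -> : map (@inl _ S) (vinput x (choice (index s starts) ++ cert os)) :: nseq 5 [::] =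
    St (encw us ++ encw vs ++ map bit bs ++ sep :: map orac (choice (index s starts) ++ cert os))
      [::] [::] [::] [::] [::].
  by rewrite init_vinput Ex embed_encode -!catA.
apply: exec_le (exec_seq H1 (exec_seq H2 (exec_seq H3 H4))) _.
rewrite /run_time; apply: leq_add; first by rewrite -Sx.
apply: leq_add; first by rewrite leq_add2r leq_add2l ecost_le.
apply: leq_add; last first.
  rewrite leq_add2r leq_mul2l; apply/orP; right; rewrite size_cat; apply: leq_trans Lv.
  rewrite size_cat leq_add2l /encw !size_rcons //.
rewrite leq_add2r leq_mul // ltnS S1 /scost leq_add2r leq_add2l ecost_le //.
Qed.
End Verifier.

(** * Polynomial bounds *)

(** The base [n.+1] is positive, so exponents can be raised freely; this gives closure under sums
    and products. *)
Definition poly_bounded (f : nat -> nat) := exists c d, forall n, f n <= c * n.+1 ^ d.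

Lemma poly_const k : poly_bounded (fun=> k).
Proof. by exists k, 0 => n; rewrite expn0 muln1. Qed.

Lemma poly_id : poly_bounded id.
Proof. by exists 1, 1 => n; rewrite expn1 mul1n. Qed.

Lemma poly_add f g : poly_bounded f -> poly_bounded g -> poly_bounded (fun n => f n + g n).
Proof.
move=> [c1 [d1 H1]] [c2 [d2 H2]]; exists (c1 + c2), (d1 + d2) => n.
rewrite mulnDl leq_add // ?(leq_trans (H1 n)) ?(leq_trans (H2 n)) //.
  by rewrite leq_mul // leq_pexp2l // leq_addr.
by rewrite leq_mul // leq_pexp2l // leq_addl.
Qed.

Lemma poly_mul f g : poly_bounded f -> poly_bounded g -> poly_bounded (fun n => f n * g n).
Proof.
move=> [c1 [d1 H1]] [c2 [d2 H2]]; exists (c1 * c2), (d1 + d2) => n.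
by rewrite expnD mulnACA leq_mul.
Qed.

(** For positive [n], [n.+1 <= 2 * n], whence the factor [2 ^ d]; the additive constant of
    [poly_bound] covers [n = 0]. *)
Lemma poly_boundP f : poly_bounded f -> exists c d, forall n, f n <= poly_bound c d n.
Proof.
move=> [c [d H]]; exists (c * 2 ^ d), d => n; apply: leq_trans (H n) _.
rewrite /poly_bound -[X in _ + X]muln1 -mulnDr -mulnA leq_mul2l; apply/orP; right.
case: n {H} => [|n]; first by rewrite exp1n muln_gt0 expn_gt0 addn_gt0 orbT.
rewrite mulnDr -expnMn; apply: leq_trans (leq_addr _ _).
case: d => [|d]; rewrite ?expn0 ?leq_exp2r //; lia.
Qed.

Theorem theorem5 (S : finType) : in_NP (@LTL_learning_lang S).
Proof.
(* The tape initially holds the input, [sep] and the certificate, at most [n + 1 + cert_length S n]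
   cells; each program step costs a sweep over stacks of at most that height plus the number of
   steps. *)
pose time n := 1 + run_time S n * (2 * (n + 1 + cert_length S n + run_time S n) + 3).
have Pt : poly_bounded (fun n => cert_length S n + time n).
  rewrite /time /cert_length /run_time /scost /ecost /ccost /run_length.
  by repeat first [apply: poly_add | apply: poly_mul | apply: poly_const | apply: poly_id].
have [c [d H]] := poly_boundP Pt.
exists (machine (@inl _ S) (verifier S)), c, d => x; split=> [|[y [_ Hacc]]].
  move=> /verifier_complete[y [s [Ly Hs]]]; exists y; split.
    exact: leq_trans Ly (leq_trans (leq_addr _ _) (H _)).
  apply: machine_accepts Hs _; apply: leq_trans (leq_trans (leq_addl _ _) (H _)).
  rewrite /time leq_add2l leq_mul // leq_add2r leq_mul2l leq_add2r /=.
  by rewrite /vinput size_cat /= !size_map addnS -addSn addn1 leq_add2l.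
have [[s|] [t [Hex Hl]]] := verifier_total x y; first exact: Hl.
by have := machine_rejects (poly_bound c d (size x)) Hex; rewrite Hacc.
Qed.
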